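(* Let $v,w\in\mathbb{R}^2$ be linearly independent and $\Lambda=\{nv+kw:(n,k)\in\mathbb{Z}^2\}$, with $D(\Lambda)=1/|\det(v,w)|$. Let $g_1,\dots,g_N\in L^2(\mathbb{R})$, let $x_1,\dots,x_N$ be distinct points of $\mathbb{R}^2$, and set $\Lambda_n:=x_n+\Lambda$. \begin{enumerate} \item If $\bigcup_{n=1}^N G(g_n,\Lambda_n)$ is minimal in $L^2(\mathbb{R})$, then it is uniformly minimal and $D(\Lambda)\le 1/N$. \item If $\bigcup_{n=1}^N G(g_n,\Lambda_n)$ is complete in $L^2(\mathbb{R})$, then $D(\Lambda)\ge 1/N$. \end{enumerate}
   Context: For $g\in L^2(\mathbb{R})$ and $(a,b)\in\mathbb{R}^2$ put $g_{ab}(t)=e^{2\pi i b t}g(t-a)$. The Gabor system is $G(g,\Lambda)=\{g_{\lambda\mu}\}_{(\lambda,\mu)\in\Lambda}$. A system is minimal if no element lies in the closed span of the others. It is uniformly minimal if these distances are bounded below by a positive constant. It is complete if its span is dense. *)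

(* Defs.v *)
From HB Require Import structures.
From mathcomp Require Import all_boot all_order all_algebra.
From mathcomp Require Import all_classical all_reals all_analysis.
From mathcomp Require Import complex.
Set Implicit Arguments. Unset Strict Implicit. Unset Printing Implicit Defensive.
Import Order.TTheory GRing.Theory Num.Theory.
Local Open Scope ring_scope.
Local Open Scope complex_scope.

Section Gabor.
Variable R : realType.

Definition cfun := R -> R[i].

Definition cRe (z : R[i]) : R := complex.Re z.
Definition cIm (z : R[i]) : R := complex.Im z.

Definition cmeasurable (f : cfun) : Prop :=
  measurable_fun [set: R] (fun t => cRe (f t)) /\
  measurable_fun [set: R] (fun t => cIm (f t)).

Definition sqnorm (f : cfun) : \bar R :=
  (\int[@lebesgue_measure R]_(t in [set: R])
     ((cRe (f t)) ^+ 2 + (cIm (f t)) ^+ 2)%:E)%E.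

Definition L2 (f : cfun) : Prop := cmeasurable f /\ (sqnorm f < +oo)%E.

(* L^2 norm (meaningful for f in L^2) *)
Definition L2norm (f : cfun) : R := Num.sqrt (fine (sqnorm f)).

Definition csub (f h : cfun) : cfun := fun t => f t - h t.

Definition expi (th : R) : R[i] := cos th +i* sin th.

Definition tfshift (g : cfun) (a b : R) : cfun :=
  fun t => expi (2 * pi * b * t) * g (t - a).

Definition lincomb (I : eqType) (e : I -> cfun) (s : seq (R[i] * I)) : cfun :=
  fun t => \sum_(p <- s) p.1 * e p.2 t.

Definition in_span_but (I : eqType) (e : I -> cfun) (i : I) (h : cfun) : Prop :=
  exists s : seq (R[i] * I), all (fun p => p.2 != i) s /\ h = lincomb e s.

Definition in_span (I : eqType) (e : I -> cfun) (h : cfun) : Prop :=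
  exists s : seq (R[i] * I), h = lincomb e s.

Definition minimal (I : eqType) (e : I -> cfun) : Prop :=
  forall i, ~ (forall eps : R, 0 < eps ->
      exists h, in_span_but e i h /\ L2norm (csub (e i) h) < eps).

Definition uniformly_minimal (I : eqType) (e : I -> cfun) : Prop :=
  exists delta : R, 0 < delta /\
    forall i h, in_span_but e i h -> delta <= L2norm (csub (e i) h).

Definition complete_system (I : eqType) (e : I -> cfun) : Prop :=
  forall f, L2 f -> forall eps : R, 0 < eps ->
    exists h, in_span e h /\ L2norm (csub f h) < eps.

Definition latpt (x v w : R * R) (p q : int) : R * R :=
  (x.1 + p%:~R * v.1 + q%:~R * w.1, x.2 + p%:~R * v.2 + q%:~R * w.2).

Definition det2 (v w : R * R) : R := v.1 * w.2 - v.2 * w.1.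

Definition lattice_density (v w : R * R) : R := 1 / `|det2 v w|.

Definition gabor_union (N : nat) (g : 'I_N -> cfun) (x : 'I_N -> R * R)
    (v w : R * R) : 'I_N * (int * int) -> cfun :=
  fun k => let pt := latpt (x k.1) v w k.2.1 k.2.2 in tfshift (g k.1) pt.1 pt.2.

End Gabor.

(* Main.v *)
Require Import Defs.
From HB Require Import structures.
From mathcomp Require Import all_boot all_order all_algebra.
From mathcomp Require Import all_classical all_reals all_analysis.
From mathcomp Require Import measurable_realfun complex.
From mathcomp Require Import zify ring lra.
Set Implicit Arguments. Unset Strict Implicit. Unset Printing Implicit Defensive.
Import Order.TTheory GRing.Theory Num.Theory.
Import numFieldNormedType.Exports.
Local Open Scope classical_set_scope.
Local Open Scope ring_scope.

(* Comparison of two Gabor systems over lattices, one uniformly minimal and the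
   other complete. By lattice invariance and compactness, completeness makes
   every time-frequency shift of a fixed f approximable, uniformly, by elements
   of the complete system whose indices stay within a bounded distance. Let V be
   spanned by the n^2 N1 elements of the first system in a parallelogram and W by
   the elements of the second one in a slightly larger parallelogram. The trace
   of P_V P_W on V is close to dim V, because P_W nearly fixes the generators and
   the dual vectors are bounded, and it is at most dim W. Dividing by n^2 gives
   the density inequality. The theorem follows by comparing the given system with
   the orthonormal basis exp(2 i pi l t) 1_[k, k+1[ in both directions. Uniform
   minimality comes for free, since lattice shifts permute the system up to
   unimodular factors. *)

(** * Semi-inner products *)

(** The order of the limits shapes the argument. The error eps is fixed first, relative to the
    minimality constant delta; it determines a radius rho valid for all translates. The margin of
    width O(rho) around the parallelogram then costs only O(n) indices against the order n^2 being
    counted, so it disappears as n grows, and only afterwards does eps/delta tend to 0. Completeness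
    alone lets approximants reach arbitrarily far, which is why it must first be made uniform.

    Compactness requires the orbit of f under time-frequency shifts to be continuous in norm. This
    is checked directly only for [chi], the indicator of [0, 1[; a general f is then reached through
    combinations of shifts of [chi], dense because the reference system is complete. That
    completeness thus serves twice: for this density, and as one side of a comparison.

    Functions equal almost everywhere are not identified, so the inner product is only positive
    semidefinite, and lying in a finite-dimensional span is often weakened to having a residual of
    norm zero. *)

Section SemiInner.
Variables (R : rcfType) (V : lmodType R) (B : V -> V -> R).
Hypothesis formDl : forall x y z, B (x + y) z = B x z + B y z.
Hypothesis formZl : forall a x z, B (a *: x) z = a * B x z.
Hypothesis formC : forall x y, B x y = B y x.
Hypothesis form_ge0 : forall x, 0 <= B x x.

Lemma formDr x y z : B z (x + y) = B z x + B z y.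
Proof. by rewrite formC formDl !(formC z). Qed.
Lemma formZr a x z : B z (a *: x) = a * B z x.
Proof. by rewrite formC formZl (formC z). Qed.
Lemma form0l z : B 0 z = 0.
Proof. by rewrite -(scale0r 0) formZl mul0r. Qed.
Lemma form0r z : B z 0 = 0.
Proof. by rewrite formC form0l. Qed.
Lemma formNl x z : B (- x) z = - B x z.
Proof. by rewrite -scaleN1r formZl mulN1r. Qed.
Lemma formNr x z : B z (- x) = - B z x.
Proof. by rewrite formC formNl formC. Qed.
Lemma formBl x y z : B (x - y) z = B x z - B y z.
Proof. by rewrite formDl formNl. Qed.
Lemma formBr x y z : B z (x - y) = B z x - B z y.
Proof. by rewrite formDr formNr. Qed.
Lemma form_suml (I : Type) (r : seq I) (P : pred I) (F : I -> V) z :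
  B (\sum_(i <- r | P i) F i) z = \sum_(i <- r | P i) B (F i) z.
Proof. by elim/big_rec2: _ => [|i a b _ <-]; rewrite ?form0l ?formDl. Qed.
Lemma form_sumr (I : Type) (r : seq I) (P : pred I) (F : I -> V) z :
  B z (\sum_(i <- r | P i) F i) = \sum_(i <- r | P i) B z (F i).
Proof. by rewrite formC form_suml; apply: eq_bigr => i _; rewrite formC. Qed.

Lemma cauchy_schwarz x y : B x y ^+ 2 <= B x x * B y y.
Proof.
have q t : 0 <= B x x + 2 * t * B x y + t ^+ 2 * B y y.
  have := form_ge0 (x + t *: y); rewrite !(formDl, formDr, formZl, formZr) (formC y x); lra.
have [y0|y0] := eqVneq (B y y) 0.
  have [->|xy0] := eqVneq (B x y) 0; first by rewrite y0 expr0n mulr0.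
  (* With [B y y = 0] the quadratic is affine in t, and this t gives it the value -1. *)
  have := q (- (B x x + 1) / (2 * B x y)).
  rewrite y0 mulr0 addr0.
  have -> : 2 * (- (B x x + 1) / (2 * B x y)) * B x y = - (B x x + 1) by field.
  lra.
have yp : 0 < B y y by rewrite lt_neqAle eq_sym y0 form_ge0.
have := q (- B x y / B y y).
have -> : B x x + 2 * (- B x y / B y y) * B x y + (- B x y / B y y) ^+ 2 * B y y
  = (B x x * B y y - B x y ^+ 2) / B y y by field.
by rewrite pmulr_lge0 ?invr_gt0// subr_ge0.
Qed.

(** Stands in for definiteness: a vector of norm zero need not be 0, but by Cauchy-Schwarz the form
    does not see it. *)
Lemma null_orth x y : B x x = 0 -> B x y = 0.
Proof.
move=> x0; have := cauchy_schwarz x y; rewrite x0 mul0r => h.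
by apply/eqP; rewrite -sqrf_eq0 eq_le h sqr_ge0.
Qed.

Lemma cauchy_schwarz_le x y a b : 0 <= a -> 0 <= b ->
  B x x <= a ^+ 2 -> B y y <= b ^+ 2 -> `|B x y| <= a * b.
Proof.
move=> a0 b0 xa yb.
rewrite -(@ler_pXn2r _ 2%N) ?nnegrE ?mulr_ge0// real_normK ?num_real// exprMn.
by apply: le_trans (cauchy_schwarz x y) _; apply: ler_pM.
Qed.

Lemma sqrt_triangle x y :
  Num.sqrt (B (x + y) (x + y)) <= Num.sqrt (B x x) + Num.sqrt (B y y).
Proof.
rewrite -(@ler_pXn2r _ 2%N) ?nnegrE ?addr_ge0 ?sqrtr_ge0//.
rewrite sqr_sqrtr// sqrrD !sqr_sqrtr//.
have := @cauchy_schwarz_le x y _ _ (sqrtr_ge0 (B x x)) (sqrtr_ge0 (B y y)).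
rewrite !sqr_sqrtr// => /(_ (lexx _) (lexx _)) /ler_normlW.
rewrite !(formDl, formDr) (formC y x); lra.
Qed.

Definition subspace (P : V -> Prop) :=
  P 0 /\ forall a x y, P x -> P y -> P (a *: x + y).

(** Inductive rather than by coefficients, so that linear properties pass to the span by induction;
    [span_family] recovers coefficients for finite families. *)
Inductive span_of (A : V -> Prop) : V -> Prop :=
| span_of_mem x of A x : span_of A x
| span_of0 : span_of A 0
| span_of_lin a x y of span_of A x & span_of A y : span_of A (a *: x + y).

Local Notation span_seq s := (span_of (fun y => y \in s)).

Lemma span_of_subspace A : subspace (span_of A).
Proof. by split=> [|a x y]; [exact: span_of0|exact: span_of_lin]. Qed.

Lemma span_of_sub (A P : V -> Prop) : subspace P -> (forall y, A y -> P y) ->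
  forall x, span_of A x -> P x.
Proof. by move=> [P0 sP] AP x; elim=> // a y z _ Py _; exact: sP. Qed.

Lemma span_of_trans (A A' : V -> Prop) x :
  span_of A x -> (forall y, A y -> span_of A' y) -> span_of A' x.
Proof. by move=> Ax h; exact: (span_of_sub (span_of_subspace A') h). Qed.

Lemma subspaceD P x y : subspace P -> P x -> P y -> P (x + y).
Proof. by move=> [_ sP] Px Py; rewrite -(scale1r x); exact: sP. Qed.
Lemma subspaceZ P a x : subspace P -> P x -> P (a *: x).
Proof. by move=> [P0 sP] Px; rewrite -(addr0 (a *: x)); exact: sP. Qed.
Lemma subspaceB P x y : subspace P -> P x -> P y -> P (x - y).
Proof.
by move=> sP Px Py; rewrite -scaleN1r; apply: subspaceD => //; apply: subspaceZ.
Qed.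
Lemma subspace_sum P (I : eqType) (r : seq I) (Q : pred I) (F : I -> V) :
  subspace P -> (forall i, i \in r -> Q i -> P (F i)) ->
  P (\sum_(i <- r | Q i) F i).
Proof.
move=> sP; elim: r => [_|i r IH h]; first by rewrite big_nil; case: sP.
have hr : P (\sum_(j <- r | Q j) F j).
  by apply: IH => j jr; apply: h; rewrite inE jr orbT.
rewrite big_cons; case: ifP => Qi //.
by apply: subspaceD => //; apply: h; rewrite ?inE ?eqxx.
Qed.

Lemma null_subspace (f : V -> V) :
  (forall x y, f (x + y) = f x + f y) -> (forall a x, f (a *: x) = a *: f x) ->
  subspace (fun x => B (f x) (f x) = 0).
Proof.
move=> fD fZ; split.
  by rewrite -(scale0r 0) fZ scale0r form0l.
move=> a x y x0 y0; rewrite fD fZ !(formDl, formDr, formZl, formZr) x0 y0.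
by rewrite (formC (f y)) null_orth// !mulr0 !addr0.
Qed.

Definition proj (u : seq V) (x : V) := \sum_(y <- u) B x y *: y.

Fixpoint onb (u : seq V) : Prop :=
  if u is y :: u' then [/\ B y y = 1, (forall z, z \in u' -> B y z = 0) & onb u']
  else True.

Lemma projD u x y : proj u (x + y) = proj u x + proj u y.
Proof. by rewrite /proj -big_split/=; apply: eq_bigr => z _; rewrite formDl scalerDl. Qed.
Lemma projZ u a x : proj u (a *: x) = a *: proj u x.
Proof. by rewrite /proj scaler_sumr; apply: eq_bigr => z _; rewrite formZl scalerA. Qed.
Lemma projB u x y : proj u (x - y) = proj u x - proj u y.
Proof. by rewrite projD -scaleN1r projZ scaleN1r. Qed.

Lemma onb_norm u y : onb u -> y \in u -> B y y = 1.
Proof.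
elim: u => // z u IH [z1 _ /IH h]; rewrite inE => /predU1P[->//|]; exact: h.
Qed.

Lemma proj_mem u y : onb u -> y \in u -> proj u y = y.
Proof.
elim: u => // z u IH [z1 zu ou]; rewrite inE /proj big_cons => /predU1P[->|yu].
  rewrite z1 scale1r big_seq big1 ?addr0// => t tu.
  by rewrite zu// scale0r.
by rewrite formC zu// scale0r add0r; exact: IH.
Qed.

Lemma proj_orth u x y : onb u -> y \in u -> B (x - proj u x) y = 0.
Proof.
move=> ou yu.
have -> : B (x - proj u x) y = B x (y - proj u y).
  rewrite formBl formBr /proj form_suml form_sumr; congr (_ - _); apply: eq_bigr => z _.
  by rewrite formZl formZr (formC z y) mulrC.
by rewrite proj_mem// subrr form0r.
Qed.

Lemma proj_span u x : span_seq u (proj u x).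
Proof.
apply: (subspace_sum (span_of_subspace _)) => z zu _.
by apply: (subspaceZ _ (span_of_subspace _)); exact: span_of_mem.
Qed.

Lemma proj_orth_span u x y : onb u -> span_seq u y -> B (x - proj u x) y = 0.
Proof.
move=> ou; elim=> [z zu||a y1 y2 _ h1 _ h2]; first exact: proj_orth.
  by rewrite form0r.
by rewrite formDr formZr h1 h2 mulr0 addr0.
Qed.

Lemma proj_orth_proj u x y : onb u -> B (x - proj u x) (proj u y) = 0.
Proof. by move=> ou; apply: proj_orth_span => //; exact: proj_span. Qed.

Lemma proj_sym u x y : B (proj u x) y = B x (proj u y).
Proof.
rewrite /proj form_suml form_sumr; apply: eq_bigr => z _.
by rewrite formZl formZr (formC z y) mulrC.
Qed.

Lemma proj_le u x : onb u -> B (proj u x) x <= B x x.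
Proof.
move=> ou.
have h := proj_orth_proj x x ou.
have := form_ge0 (x - proj u x); rewrite formBr h subr0 formBl; lra.
Qed.

(** A vector whose residual has norm zero is dropped even if the residual is not 0, so the last
    clause can only assert a null residual instead of [proj u y = y]. *)
Lemma gram_schmidt (s : seq V) : exists u, [/\ (size u <= size s)%N, onb u,
  (forall y, y \in u -> span_seq s y) &
  forall y, span_seq s y -> B (y - proj u y) (y - proj u y) = 0].
Proof.
suff [u [us ou uin suP]] : exists u, [/\ (size u <= size s)%N, onb u,
  (forall y, y \in u -> span_seq s y) &
  forall y, y \in s -> B (y - proj u y) (y - proj u y) = 0].
  exists u; split=> //; apply: span_of_sub suP.
  apply: (@null_subspace (fun y => y - proj u y)) => [x z|a x].
    by rewrite projD opprD addrACA.
  by rewrite projZ scalerBr.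
elim: s => [|x s [u [us ou uin sP]]]; first by exists [::]; split.
have sub y : span_seq s y -> span_seq (x :: s) y.
  by move=> h; apply: (span_of_trans h) => z zs; apply: span_of_mem; rewrite /= inE (zs : z \in s) orbT.
set y := x - proj u x.
have yu z : z \in u -> B y z = 0 by exact: proj_orth.
have [y0|y0] := eqVneq (B y y) 0.
  exists u; split => //; first exact: leqW.
    by move=> z /uin; exact: sub.
  by move=> z; rewrite inE => /predU1P[->//|]; exact: sP.
have yp : 0 < B y y by rewrite lt_neqAle eq_sym y0 form_ge0.
set c := (Num.sqrt (B y y))^-1.
have c2 : c * c * B y y = 1.
  by rewrite -expr2 /c exprVn sqr_sqrtr// mulVf.
have ospan : span_seq (x :: s) (c *: y).
  apply: (subspaceZ _ (span_of_subspace _)).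
  apply: (subspaceB (span_of_subspace _)).
    by apply: span_of_mem; rewrite /= inE eqxx.
  by apply: (span_of_trans (proj_span u x)) => z /uin; exact: sub.
exists (c *: y :: u); split => //.
- split=> //; first by rewrite formZl formZr mulrA.
  by move=> z zu; rewrite formZl yu// mulr0.
- by move=> z; rewrite inE => /predU1P[->//|/uin]; exact: sub.
have pE z : proj (c *: y :: u) z = (c * c * B z y) *: y + proj u z.
  by rewrite /proj big_cons formZr scalerA mulrAC.
move=> z; rewrite inE => /predU1P[->|zs]; rewrite pE.
  have -> : B x y = B y y.
    by rewrite {3}/y formBl (formC (proj u x)) /y proj_orth_proj// subr0.
  by rewrite c2 scale1r /y subrK subrr form0l.
have zy : B z y = 0.
  have -> : z = (z - proj u z) + proj u z by rewrite subrK.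
  by rewrite formDl null_orth ?sP// (formC (proj u z)) /y proj_orth_proj// addr0.
by rewrite zy mulr0 scale0r add0r sP.
Qed.

Lemma span_family (I : finType) (P : pred I) (e : I -> V) x :
  span_of (fun y => exists2 i, P i & y = e i) x ->
  exists c : I -> R, x = \sum_(i | P i) c i *: e i.
Proof.
move: x; apply: span_of_sub; last first.
  move=> _ [i Pi ->]; exists (fun j => (j == i)%:R).
  rewrite (bigD1 i)//= eqxx scale1r big1 ?addr0// => j /andP[_ /negPf->].
  by rewrite scale0r.
split.
  by exists (fun=> 0); rewrite big1// => i _; rewrite scale0r.
move=> a y z [c ->] [d ->]; exists (fun i => a * c i + d i).
by rewrite scaler_sumr -big_split/=; apply: eq_bigr => i _; rewrite scalerDl scalerA.
Qed.

(** The dual vector is the residual of [e i] after projection on the other vectors, divided by its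
    squared norm. That residual has norm at least delta by hypothesis, whence the bound. *)
Lemma dual_vector (I : finType) (e : I -> V) (delta : R) (i : I) : 0 < delta ->
  (forall c : I -> R, delta ^+ 2 <=
     B (e i - \sum_(j | j != i) c j *: e j) (e i - \sum_(j | j != i) c j *: e j)) ->
  exists d, [/\ span_of (fun y => exists j, y = e j) d,
    forall j, B (e j) d = (j == i)%:R & B d d <= delta^-1 ^+ 2].
Proof.
move=> dp hd.
have [u [_ ou uin us]] := gram_schmidt [seq e j | j <- enum I & j != i].
set s := map _ _ in uin us.
have smem y : y \in s -> exists2 j, j != i & y = e j.
  by move=> /mapP[j]; rewrite mem_filter => /andP[ji _] ->; exists j.
set d := e i - proj u (e i).
have [c pE] : exists c : I -> R, proj u (e i) = \sum_(j | j != i) c j *: e j.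
  apply: (@span_family _ (fun j => j != i)).
  apply: (span_of_trans (proj_span u (e i))) => y /uin h.
  by apply: (span_of_trans h) => z zs; apply: span_of_mem; exact: smem.
have dd : delta ^+ 2 <= B d d by rewrite /d pE; exact: hd.
have ddp : 0 < B d d by apply: lt_le_trans dd; rewrite exprn_gt0.
exists ((B d d)^-1 *: d); split.
- apply: (subspaceZ _ (span_of_subspace _)).
  apply: (subspaceB (span_of_subspace _)).
    by apply: span_of_mem; exists i.
  rewrite pE; apply: (subspace_sum (span_of_subspace _)).
  move=> j _ _; apply: (subspaceZ _ (span_of_subspace _)).
  by apply: span_of_mem; exists j.
- move=> j; rewrite formZr; have [->|ji] := eqVneq j i.
    have -> : B (e i) d = B d d.
      by rewrite {2}/d formBl (formC (proj u _)) proj_orth_proj// subr0.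
    by rewrite mulVf// gt_eqF.
  have -> : e j = (e j - proj u (e j)) + proj u (e j) by rewrite subrK.
  rewrite formDl (formC (proj u _)) proj_orth_proj// addr0 (@null_orth (e j - _)) ?mulr0 ?(negPf ji)//.
  apply: us; apply: span_of_mem; apply/mapP; exists j => //.
  by rewrite mem_filter ji mem_enum.
by rewrite formZl formZr mulVf ?gt_eqF// mulr1 exprVn lef_pV2// posrE exprn_gt0.
Qed.

(* The trace of P_V P_W on V = span e is at least #|I| (1 - eps / delta), while
   it is at most dim W because both projections are contractions. *)
Lemma rank_comparison (I : finType) (e : I -> V) (f : seq V) (delta eps : R) :
  0 < delta -> 0 <= eps ->
  (forall i (c : I -> R), delta ^+ 2 <=
     B (e i - \sum_(j | j != i) c j *: e j) (e i - \sum_(j | j != i) c j *: e j)) ->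
  (forall i, exists2 h, span_seq f h & B (e i - h) (e i - h) <= eps ^+ 2) ->
  #|I|%:R * (1 - eps / delta) <= (size f)%:R.
Proof.
move=> dp ep he hf.
have /fin_all_exists[d dP] : forall i, exists d,
    [/\ span_of (fun y => exists j, y = e j) d,
    forall j, B (e j) d = (j == i)%:R & B d d <= delta^-1 ^+ 2].
  by move=> i; exact: dual_vector (he i).
have [u [uf ou uin us]] := gram_schmidt f.
have [t [_ ot tin ts]] := gram_schmidt [seq e j | j <- enum I].
(* The trace in the basis [e] with dual basis [d]: each term differs from [B (e i) (d i) = 1] by at
   most eps / delta. *)
apply: (@le_trans _ _ (\sum_i B (proj u (e i)) (d i))).
  rewrite -sum1_card natr_sum mulr_suml; apply: ler_sum => i _; rewrite mul1r.
  have [_ /(_ i)] := dP i; rewrite eqxx /= => ed dd.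
  have : `|B (e i - proj u (e i)) (d i)| <= eps * delta^-1.
    apply: cauchy_schwarz_le => //; first by rewrite invr_ge0 ltW.
    have [h hsp] := hf i; apply: le_trans.
    (* Pythagoras: the projection residual is no longer than [e i - h] for any h in the span of
       f. *)
    have -> : e i - h = (e i - proj u (e i)) + (proj u (e i) - h) by rewrite addrA subrK.
    set x := _ - _; set y := _ - h.
    have xy : B x y = 0.
      have -> : y = (proj u (e i) - proj u h) - (h - proj u h).
        by rewrite opprB addrA subrK.
      rewrite formBr -projB proj_orth_proj// sub0r formC null_orth ?oppr0//.
      exact: us.
    clearbody x y.
    rewrite formDl !formDr (formC y) xy; have := form_ge0 y; lra.
  rewrite formBl ed => /ler_normlW; lra.
(* The same trace computed on the orthonormal family u: at most [size u] terms, each to be bounded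
   by 1. *)
have -> : \sum_i B (proj u (e i)) (d i) =
    \sum_(y <- u) B (\sum_i B y (d i) *: e i) y.
  under eq_bigr do rewrite /proj form_suml.
  rewrite exchange_big/=; apply: eq_bigr => y _; rewrite form_suml.
  by apply: eq_bigr => i _; rewrite !formZl mulrC.
apply: (@le_trans _ _ (\sum_(y <- u) 1)); last first.
  by rewrite big_const_seq count_predT iter_addr_0 ler_nat.
rewrite big_seq [leRHS]big_seq; apply: ler_sum => y yu.
rewrite -(onb_norm ou yu).
(* Expansion in [e] with the dual vectors as coefficients is the orthogonal projection on V, hence a
   contraction. *)
suff -> : \sum_i B y (d i) *: e i = proj t y by exact: proj_le.
have tsp z : span_seq [seq e j | j <- enum I] z ->
    span_of (fun y => exists2 j, xpredT j & y = e j) z.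
  by move=> h; apply: (span_of_trans h) => _ /mapP[j _ ->]; apply: span_of_mem; exists j.
have [c pE] : exists c : I -> R, proj t y = \sum_i c i *: e i.
  apply: (@span_family _ xpredT).
  by apply: (span_of_trans (proj_span t y)) => z /tin; exact: tsp.
rewrite pE; apply: eq_bigr => j _; congr (_ *: _).
have [dj edj _] := dP j.
have -> : c j = B (proj t y) (d j).
  rewrite pE form_suml (bigD1 j)//= formZl edj eqxx mulr1 big1 ?addr0// => i ij.
  by rewrite formZl edj (negPf ij) mulr0.
rewrite proj_sym; apply/eqP; rewrite -subr_eq0 -formBr formC null_orth//.
by apply: ts; apply: (span_of_trans dj) => _ [k ->]; apply: span_of_mem; apply: map_f; rewrite mem_enum.
Qed.

End SemiInner.

(** * The space L2 and time-frequency shifts *)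

Section L2space.
Variable R : realType.
Local Notation C := R[i].
Local Notation mu := (@lebesgue_measure R).

(** Real-valued, whereas the norm of [R[i]] takes its values in [R[i]]; it is the integrand of
    [sqnorm]. *)
Definition sqmod (z : C) : R := complex.Re z ^+ 2 + complex.Im z ^+ 2.
Definition dot (z w : C) : R :=
  complex.Re z * complex.Re w + complex.Im z * complex.Im w.

Lemma complex_ReM (z w : C) : complex.Re (z * w) =
  complex.Re z * complex.Re w - complex.Im z * complex.Im w.
Proof. by case: z => a b; case: w. Qed.
Lemma complex_ImM (z w : C) : complex.Im (z * w) =
  complex.Re z * complex.Im w + complex.Im z * complex.Re w.
Proof. by case: z => a b; case: w. Qed.
Lemma complex_ReD (z w : C) : complex.Re (z + w) = complex.Re z + complex.Re w.
Proof. by case: z => a b; case: w. Qed.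
Lemma complex_ImD (z w : C) : complex.Im (z + w) = complex.Im z + complex.Im w.
Proof. by case: z => a b; case: w. Qed.
Lemma complex_ReN (z : C) : complex.Re (- z) = - complex.Re z.
Proof. by case: z. Qed.
Lemma complex_ImN (z : C) : complex.Im (- z) = - complex.Im z.
Proof. by case: z. Qed.
Definition ReImE := (complex_ReM, complex_ImM, complex_ReD, complex_ImD, complex_ReN, complex_ImN).

Lemma sqmod_ge0 z : 0 <= sqmod z.
Proof. by rewrite addr_ge0 ?sqr_ge0. Qed.
Lemma sqmodM z w : sqmod (z * w) = sqmod z * sqmod w.
Proof. rewrite /sqmod !ReImE; ring. Qed.
Lemma sqmodD_le z w : sqmod (z + w) <= 2 * sqmod z + 2 * sqmod w.
Proof.
rewrite /sqmod !ReImE.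
have := sqr_ge0 (complex.Re z - complex.Re w).
have := sqr_ge0 (complex.Im z - complex.Im w).
lra.
Qed.
Lemma sqmod0 : sqmod 0 = 0. Proof. by rewrite /sqmod /= !expr0n addr0. Qed.
Lemma sqmodN z : sqmod (- z) = sqmod z.
Proof. by rewrite /sqmod !ReImE !sqrrN. Qed.
Lemma dotC z w : dot z w = dot w z. Proof. by rewrite /dot mulrC (mulrC (complex.Im z)). Qed.
Lemma dot_le z w : `|dot z w| <= sqmod z + sqmod w.
Proof.
rewrite ler_norml /dot /sqmod.
have := sqr_ge0 (complex.Re z - complex.Re w).
have := sqr_ge0 (complex.Im z - complex.Im w).
have := sqr_ge0 (complex.Re z + complex.Re w).
have := sqr_ge0 (complex.Im z + complex.Im w).
have := sqmod_ge0 z; have := sqmod_ge0 w; rewrite /sqmod => *.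
apply/andP; split; lra.
Qed.

Lemma cmeasurableD (f h : cfun R) : cmeasurable f -> cmeasurable h ->
  cmeasurable (fun t => f t + h t).
Proof.
move=> [f1 f2] [h1 h2]; split; rewrite /cRe /cIm.
  by under eq_fun do rewrite complex_ReD; exact: measurable_funD.
by under eq_fun do rewrite complex_ImD; exact: measurable_funD.
Qed.

Lemma cmeasurableM (f h : cfun R) : cmeasurable f -> cmeasurable h ->
  cmeasurable (fun t => f t * h t).
Proof.
move=> [f1 f2] [h1 h2]; split; rewrite /cRe /cIm.
  under eq_fun do rewrite complex_ReM.
  by apply: measurable_funB; exact: measurable_funM.
under eq_fun do rewrite complex_ImM.
by apply: measurable_funD; exact: measurable_funM.
Qed.

Lemma cmeasurable_cst (c : C) : cmeasurable (fun _ : R => c).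
Proof. by split; exact: measurable_cst. Qed.

Lemma measurable_sqmod (f : cfun R) : cmeasurable f ->
  measurable_fun setT (fun t => sqmod (f t)).
Proof. by move=> [f1 f2]; apply: measurable_funD; exact: measurable_funX. Qed.

Lemma measurable_dot (f h : cfun R) : cmeasurable f -> cmeasurable h ->
  measurable_fun setT (fun t => dot (f t) (h t)).
Proof. by move=> [f1 f2] [h1 h2]; apply: measurable_funD; exact: measurable_funM. Qed.

Lemma L2P (f : cfun R) :
  L2 f <-> cmeasurable f /\ mu.-integrable setT (fun t => (sqmod (f t))%:E).
Proof.
split=> -[mf fi]; split => //.
  apply/integrableP; split.
    by apply/measurable_EFinP; exact: measurable_sqmod.
  by under eq_integral do rewrite gee0_abs ?lee_fin ?sqmod_ge0//.
move/integrableP : fi => [_].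
by under eq_integral do rewrite gee0_abs ?lee_fin ?sqmod_ge0//.
Qed.

Lemma L2_le (f h : cfun R) (k : R) : cmeasurable f -> L2 h ->
  (forall t, sqmod (f t) <= k * sqmod (h t)) -> L2 f.
Proof.
move=> mf /L2P[mh ih] fh; apply/L2P; split => //.
apply: (@le_integrable _ _ _ mu setT measurableT _ (fun t => (k%:E * (sqmod (h t))%:E)%E)) => //.
- by apply/measurable_EFinP; exact: measurable_sqmod.
- move=> t _; rewrite /= lee_fin (ger0_norm (sqmod_ge0 _)).
  by apply: le_trans (fh t) _; exact: ler_norm.
- exact: integrableZl.
Qed.

Lemma L2D (f h : cfun R) : L2 f -> L2 h -> L2 (fun t => f t + h t).
Proof.
move=> /L2P[mf fi] /L2P[mh ih]; apply/L2P; split; first exact: cmeasurableD.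
apply: (@le_integrable _ _ _ mu setT measurableT _
  (fun t => (2%:E * (sqmod (f t))%:E + 2%:E * (sqmod (h t))%:E)%E)) => //.
- by apply/measurable_EFinP; apply: measurable_sqmod; exact: cmeasurableD.
- move=> t _; rewrite /= lee_fin (ger0_norm (sqmod_ge0 _)).
  by apply: le_trans (sqmodD_le _ _) _; exact: ler_norm.
- by apply: integrableD => //; exact: integrableZl.
Qed.

Lemma L2M (c f : cfun R) (k : R) : cmeasurable c -> L2 f ->
  (forall t, sqmod (c t) <= k) -> L2 (fun t => c t * f t).
Proof.
move=> mc Lf ck; apply: (L2_le (h := f) (k := k)) => //.
  by apply: cmeasurableM => //; case: Lf.
by move=> t; rewrite sqmodM ler_wpM2r ?sqmod_ge0.
Qed.

Lemma L2Z (c : C) (f : cfun R) : L2 f -> L2 (fun t => c * f t).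
Proof. by move=> Lf; apply: (L2M (k := sqmod c)) => //; exact: cmeasurable_cst. Qed.

Lemma L20 : L2 (fun _ : R => 0 : C).
Proof.
split; first exact: cmeasurable_cst.
rewrite /sqnorm integral0_eq// => t _.
by have := sqmod0; rewrite /sqmod /cRe /cIm => ->.
Qed.

Lemma L2B (f h : cfun R) : L2 f -> L2 h -> L2 (fun t => f t - h t).
Proof.
move=> Lf Lh; have := L2D Lf (L2Z (-1) Lh).
by congr L2; apply/funext => t; rewrite mulN1r.
Qed.

Definition ip (f h : cfun R) : R := \int[mu]_(t in setT) dot (f t) (h t).

Lemma integrable_dot (f h : cfun R) : L2 f -> L2 h ->
  mu.-integrable setT (EFin \o (fun t => dot (f t) (h t))).
Proof.
move=> /L2P[mf fi] /L2P[mh ih].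
apply: (@le_integrable _ _ _ mu setT measurableT _
  (fun t => ((sqmod (f t))%:E + (sqmod (h t))%:E)%E)) => //.
- by apply/measurable_EFinP; exact: measurable_dot.
- move=> t _; rewrite /= lee_fin; apply: le_trans (dot_le _ _) _.
  exact: ler_norm.
- exact: integrableD.
Qed.

Lemma ipC f h : ip f h = ip h f.
Proof. by congr Rintegral; apply/funext => t; rewrite dotC. Qed.

Lemma ipDl f1 f2 h : L2 f1 -> L2 f2 -> L2 h ->
  ip (fun t => f1 t + f2 t) h = ip f1 h + ip f2 h.
Proof.
move=> L1 L2' Lh; rewrite /ip -RintegralD//; try exact: integrable_dot.
by congr Rintegral; apply/funext => t; rewrite /dot !ReImE; ring.
Qed.

Lemma ipZl (a : R) f h : L2 f -> L2 h ->
  ip (fun t => (a%:C)%C * f t) h = a * ip f h.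
Proof.
move=> Lf Lh; rewrite /ip -RintegralZl//; try exact: integrable_dot.
by congr Rintegral; apply/funext => t; rewrite /dot !ReImE /=; ring.
Qed.

Lemma ipE f : ip f f = fine (sqnorm f).
Proof. by []. Qed.

Lemma ip_ge0 f : 0 <= ip f f.
Proof.
by apply: Rintegral_ge0 => t _; rewrite /dot -!expr2; exact: sqmod_ge0.
Qed.

Definition isL2 : {pred R -> C} := fun f => `[< L2 f >].

Lemma isL2_zmod : zmod_closed isL2.
Proof.
split; first by apply/asboolP; exact: L20.
by move=> f h /asboolP Lf /asboolP Lh; apply/asboolP; exact: L2B.
Qed.
HB.instance Definition _ := GRing.isZmodClosed.Build (R -> C) isL2 isL2_zmod.

Record L2sp := MkL2 { L2val :> R -> C; _ : L2val \in isL2 }.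
HB.instance Definition _ := [isSub for L2val].
HB.instance Definition _ := [Choice of L2sp by <:].
HB.instance Definition _ := [SubChoice_isSubZmodule of L2sp by <:].

Lemma L2spP (f : L2sp) : L2 (f : R -> C).
Proof. by case: f => f h; apply/asboolP. Qed.

Definition toL2 (f : cfun R) (Lf : L2 f) : L2sp := MkL2 (introT (asboolP _) Lf).

Definition L2scale (c : C) (f : L2sp) : L2sp := toL2 (L2Z c (L2spP f)).

Lemma L2sp_eq (f h : L2sp) : (forall t, (f : R -> C) t = (h : R -> C) t) -> f = h.
Proof. by move=> fh; apply/val_inj/funext. Qed.

(* Only real scalars: the inner product [ip] is the real part of the Hermitian
   one. *)
Definition L2rscale (a : R) (f : L2sp) : L2sp := L2scale (a%:C)%C f.

Lemma L2rscaleA a b f : L2rscale a (L2rscale b f) = L2rscale (a * b) f.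
Proof. by apply: L2sp_eq => t /=; rewrite mulrA -rmorphM. Qed.
Lemma L2rscale1 : left_id 1 L2rscale.
Proof. by move=> f; apply: L2sp_eq => t /=; rewrite mul1r. Qed.
Lemma L2rscaleDr : right_distributive L2rscale +%R.
Proof. by move=> a f h; apply: L2sp_eq => t /=; rewrite mulrDr. Qed.
Lemma L2rscaleDl f : {morph L2rscale^~ f : a b / a + b}.
Proof. by move=> a b; apply: L2sp_eq => t /=; rewrite rmorphD mulrDl. Qed.
HB.instance Definition _ := GRing.Zmodule_isLmodule.Build R L2sp
  L2rscaleA L2rscale1 L2rscaleDr L2rscaleDl.

Definition L2ip (f h : L2sp) : R := ip (f : R -> C) (h : R -> C).

Lemma L2ipDl (f1 f2 h : L2sp) : L2ip (f1 + f2) h = L2ip f1 h + L2ip f2 h.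
Proof. by apply: ipDl; exact: L2spP. Qed.
Lemma L2ipZl (a : R) (f h : L2sp) : L2ip (a *: f) h = a * L2ip f h.
Proof. by apply: ipZl; exact: L2spP. Qed.
Lemma L2ipC (f h : L2sp) : L2ip f h = L2ip h f.
Proof. exact: ipC. Qed.
Lemma L2ip_ge0 (f : L2sp) : 0 <= L2ip f f.
Proof. exact: ip_ge0. Qed.

Lemma L2normE f : L2norm f = Num.sqrt (ip f f). Proof. by []. Qed.

Lemma L2norm_ge0 (f : cfun R) : 0 <= L2norm f. Proof. exact: sqrtr_ge0. Qed.

Lemma L2normD (f h : cfun R) : L2 f -> L2 h ->
  L2norm (fun t => f t + h t) <= L2norm f + L2norm h.
Proof.
move=> Lf Lh.
exact: (sqrt_triangle L2ipDl L2ipZl L2ipC L2ip_ge0 (toL2 Lf) (toL2 Lh)).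
Qed.

Lemma eq_L2norm (f h : cfun R) : (forall t, sqmod (f t) = sqmod (h t)) ->
  L2norm f = L2norm h.
Proof.
move=> fh; congr (Num.sqrt (fine _)); apply: eq_integral => t _.
by have := fh t; rewrite /sqmod /cRe /cIm => ->.
Qed.

Lemma L2normZ (c : C) (f : cfun R) : L2 f ->
  L2norm (fun t => c * f t) = Num.sqrt (sqmod c) * L2norm f.
Proof.
move=> Lf; rewrite (@eq_L2norm _ (fun t => ((Num.sqrt (sqmod c))%:C)%C * f t)).
  rewrite !L2normE ipZl//; last exact: L2Z.
  rewrite ipC ipZl//.
  by rewrite mulrA -expr2 sqr_sqrtr ?sqmod_ge0// sqrtrM ?sqmod_ge0//.
move=> t; rewrite !sqmodM; congr (_ * _).
by rewrite {2}/sqmod /= expr0n addr0 sqr_sqrtr ?sqmod_ge0.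
Qed.

Definition shiftR (a : R) : measurableTypeR R -> measurableTypeR R := fun t => t - a.

(** The pushforward gives half-open intervals their length, which characterizes Lebesgue measure. *)
Lemma lebesgue_measure_shift (a : R) (A : set R) : measurable A ->
  pushforward mu (shiftR a) A = mu A.
Proof.
have mshift : measurable_fun setT (shiftR a) by exact: measurable_funB.
move=> mA; apply/esym/lebesgue_measure_unique => //= _ [[x y]] _ <-.
rewrite /pushforward.
have -> : shiftR a @^-1` `]x, y]%classic = `]x + a, y + a]%classic.
  by apply/seteqP; split=> t; rewrite /= !in_itv/= /shiftR ltrBrDr lerBlDr.
rewrite !lebesgue_measure_itv/= !lte_fin ltrD2r; case: ifP => // _.
by rewrite -!EFinB; congr (_%:E); ring.
Qed.

Lemma integral_shift (a : R) (f : R -> R) : measurable_fun setT f ->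
  (forall t, 0 <= f t) ->
  (\int[mu]_(t in setT) (f (t - a))%:E = \int[mu]_(t in setT) (f t)%:E)%E.
Proof.
move=> mf f0.
have mshift : measurable_fun setT (shiftR a) by exact: measurable_funB.
transitivity (\int[pushforward mu (shiftR a)]_(t in setT) (f t)%:E)%E.
  rewrite (ge0_integral_pushforward mshift)//; first by apply/measurable_EFinP.
  by move=> t _; rewrite lee_fin.
apply: eq_measure_integral => //= A mA _; exact: lebesgue_measure_shift.
Qed.

Lemma sqmod_expi th : sqmod (expi th) = 1 :> R.
Proof. by rewrite /sqmod /expi /= cos2Dsin2. Qed.

Lemma measurable_shift (f : R -> R) (a : R) : measurable_fun setT f ->
  measurable_fun setT (fun t : R => f (t - a)).
Proof.
move=> mf; apply: (measurableT_comp (f := f) (g := shiftR a)) => //.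
exact: measurable_funB.
Qed.

Lemma cmeasurable_expi (b : R) : cmeasurable (fun t => expi (2 * pi * b * t)).
Proof.
split; rewrite /cRe /cIm /expi /=; apply: continuous_measurable_fun => t.
  apply: continuous_comp; last exact: continuous_cos.
  exact: mulrl_continuous.
apply: continuous_comp; last exact: continuous_sin.
exact: mulrl_continuous.
Qed.

Lemma sqmod_tfshift (g : cfun R) a b t : sqmod (tfshift g a b t) = sqmod (g (t - a)).
Proof. by rewrite sqmodM sqmod_expi mul1r. Qed.

Lemma sqnorm_tfshift (g : cfun R) a b : cmeasurable g ->
  sqnorm (tfshift g a b) = sqnorm g.
Proof.
move=> mg; rewrite /sqnorm.
rewrite -[RHS](integral_shift a (measurable_sqmod mg) (fun t => sqmod_ge0 _)).
by apply: eq_integral => t _; congr EFin; exact: sqmod_tfshift.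
Qed.

Lemma L2_tfshift (g : cfun R) a b : L2 g -> L2 (tfshift g a b).
Proof.
move=> [mg gi]; split; last by rewrite sqnorm_tfshift.
apply: cmeasurableM; first exact: cmeasurable_expi.
by case: mg => m1 m2; split; [exact: (measurable_shift a m1)|exact: (measurable_shift a m2)].
Qed.

Lemma L2norm_tfshift (g : cfun R) a b : L2 g -> L2norm (tfshift g a b) = L2norm g.
Proof. by move=> [mg _]; rewrite /L2norm sqnorm_tfshift. Qed.

(** Dominated convergence for |h - f n|^2, with the integrable majorant 2|h|^2 + 2|G|^2. *)
Lemma L2_dominated (f : nat -> cfun R) (h G : cfun R) :
  (forall n, cmeasurable (f n)) -> L2 h -> L2 G ->
  (forall n t, sqmod (f n t) <= sqmod (G t)) ->
  {ae mu, forall t, (fun n => complex.Re (f n t)) @ \oo --> complex.Re (h t) /\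
                    (fun n => complex.Im (f n t)) @ \oo --> complex.Im (h t)} ->
  forall eps : R, 0 < eps -> exists n, L2norm (csub h (f n)) < eps.
Proof.
move=> mf Lh LG fG fReIm eps e0.
set F := fun n t => (sqmod (h t - f n t))%:E.
set M := fun t => (2%:E * (sqmod (h t))%:E + 2%:E * (sqmod (G t))%:E)%E.
have mF n : measurable_fun setT (F n).
  apply/measurable_EFinP; apply: measurable_sqmod.
  apply: (cmeasurableD (f := h)); first by case: Lh.
  have := cmeasurableM (cmeasurable_cst (-1)) (mf n).
  by congr cmeasurable; apply/funext => t; rewrite mulN1r.
have F0 : {ae mu, forall t, setT t -> F ^~ t @ \oo --> (cst 0%E : R -> \bar R) t}.
  apply: negligibleS fReIm => t /= nF [fRe fIm]; apply: nF => _.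
  apply/fine_cvgP; split; first exact: nearW.
  have -> : fine \o F ^~ t = fun n =>
      (complex.Re (h t) - complex.Re (f n t)) * (complex.Re (h t) - complex.Re (f n t)) +
      (complex.Im (h t) - complex.Im (f n t)) * (complex.Im (h t) - complex.Im (f n t)).
    by apply/funext => n; rewrite /F /= /sqmod !ReImE !expr2.
  have Re0 : (fun n => complex.Re (h t) - complex.Re (f n t)) @ \oo --> (0 : R).
    by rewrite -(subrr (complex.Re (h t))); apply: cvgB => //; exact: cvg_cst.
  have Im0 : (fun n => complex.Im (h t) - complex.Im (f n t)) @ \oo --> (0 : R).
    by rewrite -(subrr (complex.Im (h t))); apply: cvgB => //; exact: cvg_cst.
  suff : (fun n =>
      (complex.Re (h t) - complex.Re (f n t)) * (complex.Re (h t) - complex.Re (f n t)) +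
      (complex.Im (h t) - complex.Im (f n t)) * (complex.Im (h t) - complex.Im (f n t)))
      @ \oo --> (0 * 0 + 0 * 0 : R) by rewrite mulr0 addr0.
  by apply: cvgD; apply: cvgM.
have iM : mu.-integrable setT M.
  move/L2P : Lh => [_ ih]; move/L2P : LG => [_ iG].
  by apply: integrableD => //; exact: integrableZl.
have FM : {ae mu, forall t n, setT t -> (`|F n t| <= M t)%E}.
  apply: aeW => t n _; rewrite /= ger0_norm ?sqmod_ge0// lee_fin.
  apply: le_trans (sqmodD_le _ _) _; rewrite lerD2l ler_wpM2l//.
  by rewrite sqmodN.
have [_ _] := @dominated_convergence _ _ _ mu setT measurableT F (cst 0%E) M
  mF (measurable_cst _) F0 iM FM.
rewrite integral0 => /fine_cvgP[_ /cvgrPdist_lt /(_ _ (exprn_gt0 2 e0))].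
move=> [n _ /(_ n (leqnn n))] /=.
rewrite sub0r normrN => /ltr_normlW hn; exists n.
rewrite -(@ltr_pXn2r _ 2%N) ?nnegrE ?L2norm_ge0 ?ltW// /L2norm sqr_sqrtr ?ip_ge0//.
Qed.

Lemma expiD (a b : R) : expi (a + b) = expi a * expi b.
Proof. by rewrite /expi cosD sinD; apply/eqP; rewrite eq_complex /= eqxx addrC eqxx. Qed.

Lemma expi0 : expi 0 = 1 :> C.
Proof. by rewrite /expi cos0 sin0. Qed.

Lemma expiN (a : R) : expi a * expi (- a) = 1.
Proof. by rewrite -expiD subrr expi0. Qed.

(** Time-frequency shifts form only a projective representation of R^2. The factor is a unimodular
    constant, so norms and spans are unaffected and it can be absorbed in coefficients. *)
Lemma tfshift_tfshift (f : cfun R) a b c d :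
  tfshift (tfshift f a b) c d =
  fun t => expi (- (2 * pi * b * c)) * tfshift f (a + c) (b + d) t.
Proof.
apply/funext => t; rewrite /tfshift !mulrA -!expiD.
by congr (expi _ * f _); ring.
Qed.

Lemma tfshiftB (f h : cfun R) a b :
  tfshift (csub f h) a b = csub (tfshift f a b) (tfshift h a b).
Proof. by apply/funext => t; rewrite /tfshift /csub mulrBr. Qed.

Lemma tfshift_lincomb (I : eqType) (e : I -> cfun R) s a b :
  tfshift (lincomb e s) a b = lincomb (fun i => tfshift (e i) a b) s.
Proof.
apply/funext => t; rewrite /tfshift /lincomb mulr_sumr; apply: eq_bigr => p _.
by rewrite mulrCA.
Qed.

Lemma L2_lincomb (I : eqType) (e : I -> cfun R) s :
  (forall i, L2 (e i)) -> L2 (lincomb e s).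
Proof.
move=> Le; elim: s => [|p s IH].
  by rewrite (_ : lincomb e [::] = fun=> 0); [exact: L20|
    apply/funext => t; rewrite /lincomb big_nil].
rewrite (_ : lincomb e (p :: s) = fun t => p.1 * e p.2 t + lincomb e s t).
  by apply: L2D => //; exact: L2Z.
by apply/funext => t; rewrite /lincomb big_cons.
Qed.

Lemma lincomb_cat (I : eqType) (e : I -> cfun R) s1 s2 t :
  lincomb e (s1 ++ s2) t = lincomb e s1 t + lincomb e s2 t.
Proof. by rewrite /lincomb big_cat. Qed.

Lemma lincomb_scale (I : eqType) (e : I -> cfun R) (c : C) s t :
  lincomb e [seq (c * p.1, p.2) | p <- s] t = c * lincomb e s t.
Proof.
by rewrite /lincomb big_map mulr_sumr; apply: eq_bigr => p _; rewrite mulrA.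
Qed.

Lemma lincomb_map (I J : eqType) (e : I -> cfun R) (e' : J -> cfun R)
    (sh : I -> J) (ph : I -> C) s :
  (forall i t, e i t = ph i * e' (sh i) t) ->
  lincomb e s = lincomb e' [seq (p.1 * ph p.2, sh p.2) | p <- s].
Proof.
move=> ee'; apply/funext => t; rewrite /lincomb big_map; apply: eq_bigr => p _.
by rewrite ee' mulrA.
Qed.

End L2space.

(** * Invariance of a Gabor system under its lattice *)

Section GaborSystem.
Variables (R : realType) (N : nat) (g : 'I_N -> cfun R) (x : 'I_N -> R * R).
Variables (v w : R * R).
Hypothesis Lg : forall n, L2 (g n).
Local Notation C := R[i].
Local Notation E := (gabor_union g x v w).

Lemma L2_gabor i : L2 (E i).
Proof. exact: L2_tfshift. Qed.

Definition lat0 (p q : int) : R * R := latpt (0, 0) v w p q.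

Definition shidx (p q : int) (i : 'I_N * (int * int)) : 'I_N * (int * int) :=
  (i.1, (i.2.1 + p, i.2.2 + q)).

Definition phase (p q : int) (i : 'I_N * (int * int)) : C :=
  expi (- (2 * pi * (latpt (x i.1) v w i.2.1 i.2.2).2 * (lat0 p q).1)).

Lemma gabor_shift p q i t :
  tfshift (E i) (lat0 p q).1 (lat0 p q).2 t = phase p q i * E (shidx p q i) t.
Proof.
rewrite tfshift_tfshift; congr (_ * _); rewrite /gabor_union /shidx /=.
by congr (tfshift _ _ _ _); rewrite !rmorphD /=; ring.
Qed.

Lemma lincomb_shift p q s : exists s',
  [/\ tfshift (lincomb E s) (lat0 p q).1 (lat0 p q).2 = lincomb E s' &
      [seq c.2 | c <- s'] = [seq shidx p q c.2 | c <- s]].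
Proof.
exists [seq (c.1 * phase p q c.2, shidx p q c.2) | c <- s]; split.
  by rewrite tfshift_lincomb; apply: lincomb_map => i t; exact: gabor_shift.
by rewrite -map_comp.
Qed.

Lemma L2norm_phase (f h : cfun R) th :
  L2norm (fun t => expi th * f t - h t) = L2norm (fun t => f t - expi (- th) * h t).
Proof.
apply: eq_L2norm => t.
have -> : expi th * f t - h t = expi th * (f t - expi (- th) * h t).
  by rewrite mulrBr mulrA expiN mul1r.
by rewrite sqmodM sqmod_expi mul1r.
Qed.

(** The shift by -(p v + q w) is an isometry carrying the element of index (n, (p, q)) to a
    unimodular multiple of the one at (n, (0, 0)), and combinations of the other elements to
    combinations of the others. One constant per n therefore suffices. *)
Lemma uniformly_minimal_of_origin :
  (forall n, exists2 d : R, 0 < d & forall h, in_span_but E (n, (0, 0)) h ->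
     d <= L2norm (csub (E (n, (0, 0))) h)) ->
  uniformly_minimal E.
Proof.
move=> /fin_all_exists2[d d0 dP].
(* The initial value 1 keeps the minimum positive when N = 0. *)
exists (\big[Num.min/1]_n d n); split.
  by elim/big_ind: _ => // a b a0 b0; rewrite lt_min a0 b0.
move=> [n [p q]] _ [s [sb ->]].
apply: (@le_trans _ _ (d n)).
  by rewrite (bigD1 n)//= ge_min lexx.
have Ls : L2 (lincomb E s) by apply: L2_lincomb => i; exact: L2_gabor.
rewrite -(L2norm_tfshift (lat0 (- p) (- q)).1 (lat0 (- p) (- q)).2); last first.
  by apply: L2B => //; exact: L2_gabor.
rewrite tfshiftB.
have [s' [-> s'E]] := lincomb_shift (- p) (- q) s.
rewrite (_ : csub _ _ = fun t =>
    phase (- p) (- q) (n, (p, q)) * E (n, (0, 0)) t - lincomb E s' t); last first.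
  by apply/funext => t; rewrite /csub gabor_shift /shidx /= !subrr.
rewrite L2norm_phase; apply: dP.
(* Removing the phase of the moved element rescales the coefficients of the combination and keeps
   its indices. *)
exists [seq (expi (- - (2 * pi * (latpt (x n) v w p q).2 *
  (lat0 (- p) (- q)).1)) * c.1, c.2) | c <- s'].
split; last by apply/funext => t; rewrite lincomb_scale.
rewrite all_map /preim /=.
have : all (fun i => i != (n, (0, 0))) [seq c.2 | c <- s'].
  rewrite s'E all_map; apply: sub_all sb => -[c [m [p' q']]] /=.
  by apply: contraNneq => -[-> /eqP]; rewrite subr_eq0 => /eqP -> /eqP;
    rewrite subr_eq0 => /eqP ->.
by rewrite all_map.
Qed.

Lemma minimal_uniformly : minimal E -> uniformly_minimal E.
Proof.
move=> mE; apply: uniformly_minimal_of_origin => n.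
have /existsNP[d /not_implyP[d0 dP]] := mE (n, (0, 0)).
exists d => // h hs; rewrite leNgt; apply/negP => hd; apply: dP.
by exists h.
Qed.

End GaborSystem.

(** * The reference orthonormal system *)

Section ReferenceSystem.
Variable R : realType.
Local Notation C := R[i].
Local Notation mu := (@lebesgue_measure R).

Lemma expi_nat (n : nat) : expi (2 * pi * n%:R) = 1 :> C.
Proof.
elim: n => [|n IH]; first by rewrite mulr0 expi0.
rewrite -(natr1 n) mulrDr mulr1 expiD IH mul1r (_ : 2 * pi = pi *+ 2).
  by rewrite /expi cos2pi sin2pi.
by rewrite mulr_natl.
Qed.

Lemma expi_int (m : int) : expi (2 * pi * m%:~R) = 1 :> C.
Proof.
case: m => n; first exact: expi_nat.
have := expiN (2 * pi * (n.+1%:R : R)); rewrite expi_nat mul1r => <-.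
by rewrite NegzE rmorphN mulrN.
Qed.

Definition chi : cfun R := fun t => ((0 <= t < 1)%R)%:R.

Lemma chiE t : chi t = ((\1_(`[0, 1[%classic : set R) t)%:C)%C.
Proof. by rewrite indicE /chi mem_setE in_itv /=; case: (0 <= t < 1). Qed.

Lemma cmeasurable_real (f : R -> R) : measurable_fun setT f ->
  cmeasurable (fun t => (f t)%:C)%C.
Proof. by move=> mf; split => //; exact: measurable_cst. Qed.

Lemma cmeasurable_chi : cmeasurable chi.
Proof.
rewrite (_ : chi = fun t => ((\1_(`[0, 1[%classic : set R) t)%:C)%C).
  by apply: cmeasurable_real; exact: measurable_indic.
by apply/funext => t; exact: chiE.
Qed.

Lemma sqmod_real (a : R) : sqmod (a%:C)%C = a ^+ 2.
Proof. by rewrite /sqmod /= expr0n addr0. Qed.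

Lemma sqmod_nat (b : bool) : sqmod (b%:R : C) = b%:R :> R.
Proof. by case: b; rewrite /sqmod /= ?expr0n ?expr1n addr0. Qed.

Lemma sqmod_chi t : sqmod (chi t) = \1_(`[0, 1[%classic : set R) t.
Proof. by rewrite indicE mem_setE in_itv /= sqmod_nat. Qed.

Lemma sqnorm_chi : sqnorm chi = 1%E.
Proof.
rewrite /sqnorm; under eq_integral do rewrite -/(sqmod _) sqmod_chi.
rewrite integral_indic// setIT; have := lebesgue_measure_itv `[0%R, 1%R[ => /= ->.
by rewrite lte_fin ltr01 oppr0 adde0.
Qed.

Lemma L2_chi : L2 chi.
Proof. by split; [exact: cmeasurable_chi|rewrite sqnorm_chi ltry]. Qed.

Lemma ip_chi_chi : ip chi chi = 1.
Proof. by rewrite ipE sqnorm_chi. Qed.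

(** The explicit primitive F takes equal values at 0 and 1 because m is an integer; m nonzero allows
    the division by [om]. *)
Lemma integral_trig (a b : R) (m : int) : m != 0 ->
  \int[mu]_(t in `[0, 1[) (a * cos (2 * pi * m%:~R * t) - b * sin (2 * pi * m%:~R * t)) = 0.
Proof.
move=> m0; set om := 2 * pi * m%:~R.
have om0 : om != 0.
  by rewrite !mulf_neq0 ?pnatr_eq0 ?intr_eq0//; rewrite gt_eqF ?pi_gt0.
pose f t := a * cos (om * t) - b * sin (om * t).
pose F t : R := om^-1 * (a * sin (om * t) + b * cos (om * t)).
have dF (t : R) : is_derive t (1 : R) F (f t).
  rewrite /F /f.
  have h1 : is_derive t (1 : R) (fun t : R => om * t) om.
    by apply: is_derive_eq; rewrite /GRing.scale /= mulr1.
  have h2 := @is_derive1_comp _ sin (fun t => om * t) t _ _ (is_derive_sin _) h1.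
  have h3 := @is_derive1_comp _ cos (fun t => om * t) t _ _ (is_derive_cos _) h1.
  have h4 : is_derive t (1 : R) (fun t : R =>
      om^-1 * (a * (sin \o (fun t => om * t)) t +
        b * (cos \o (fun t => om * t)) t)) (f t).
    by apply: is_derive_eq; rewrite /f /GRing.scale /=; field.
  exact: h4.
have cF (t : R) : {for t, continuous F}.
  by apply: differentiable_continuous; apply/derivable1_diffP; case: (dF t).
have cf : continuous f.
  move=> t; apply: cvgB; apply: cvgM; try exact: cvg_cst.
    by apply: continuous_comp; [exact: mulrl_continuous|exact: continuous_cos].
  by apply: continuous_comp; [exact: mulrl_continuous|exact: continuous_sin].
rewrite /Rintegral integral_itv_bndo_bndc; last first.
  apply/measurable_EFinP; apply: measurable_funTS.
  exact: continuous_measurable_fun.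
rewrite (@continuous_FTC2 _ f F)//.
- have := expi_int m; rewrite /expi -/om => -[c1 s0].
  by rewrite /F mulr1 mulr0 c1 s0 cos0 sin0 -EFinB subrr.
- exact: continuous_subspaceT.
- split.
  + by move=> t _; case: (dF t).
  + exact/cvg_at_right_filter/cF.
  + exact/cvg_at_left_filter/cF.
- by move=> t _; rewrite derive1E; exact: (@derive_val _ _ _ _ _ _ _ (dF t)).
Qed.

(** For k nonzero the supports are disjoint; for k = 0 a nontrivial character is integrated over a
    period. The arbitrary c turns orthogonality for the real form [ip] into Hermitian
    orthogonality. *)
Lemma ip_tfshift_chi (c : C) (k l : int) : (k, l) != (0, 0) ->
  ip (fun t => c * tfshift chi k%:~R l%:~R t) chi = 0.
Proof.
move=> kl; have [k0|k0] := eqVneq k 0; last first.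
  rewrite /ip (_ : (fun t => _) = cst 0) ?Rintegral_cst ?mul0r//.
  apply/funext => t; rewrite /tfshift /chi.
  case: (boolP (0 <= t < 1)) => [/andP[t0 t1]|_]; last by rewrite /dot !ReImE/=; ring.
  case: (boolP (0 <= t - _ < 1)) => [/andP[u0 u1]|_]; last by rewrite /dot !ReImE/=; ring.
  have : (-1 < k < 1).
    by apply/andP; split; rewrite -(ltr_int R) /=; lra.
  by move: k0; clear; lia.
have l0 : l != 0 by move: kl; rewrite k0; apply: contraNneq => ->.
rewrite -[RHS](integral_trig (complex.Re c) (complex.Im c) l0).
rewrite Rintegral_mkcond; congr Rintegral; apply/funext => t.
rewrite /tfshift k0 mulr0z subr0 /dot /patch mem_setE in_itv /= /chi.
by case: (0 <= t < 1); rewrite !ReImE /expi /=; [ring|rewrite !mulr0 addr0].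
Qed.

(** Both orders of the standard basis are kept because [comparison] needs a generator of one lattice
    that is not parallel to a generator of the other; b selects a suitable order. *)
Definition rv (b : bool) : R * R := if b then (1, 0) else (0, 1).
Definition refsys b := gabor_union (fun _ : 'I_1 => chi) (fun _ => (0, 0)) (rv b) (rv (~~ b)).

Lemma refsysE b n p q : refsys b (n, (p, q)) =
  tfshift chi (if b then p else q)%:~R (if b then q else p)%:~R.
Proof. by rewrite /refsys /gabor_union /latpt; case: b; congr tfshift => /=; ring. Qed.

(** The constant is 1: if h is a combination of the other elements, then chi - h has inner product 1
    with the unit vector chi, so its norm is at least 1 by Cauchy-Schwarz. *)
Lemma refsys_uniformly_minimal b : uniformly_minimal (refsys b).
Proof.
apply: uniformly_minimal_of_origin => n; first exact: L2_chi.
exists 1 => // h [s [sb ->]].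
have Le i : L2 (refsys b i) by apply: L2_gabor => _; exact: L2_chi.
have E0 : refsys b (n, (0, 0)) = chi.
  by rewrite refsysE !if_same; apply/funext => t; rewrite /tfshift mulr0 mul0r expi0 mul1r subr0.
rewrite -/(refsys b) E0.
have h0 : ip (lincomb (refsys b) s) chi = 0.
  elim: s sb => [|[c [m [p q]]] s IH] /=.
    by rewrite /lincomb /ip (_ : (fun t => _) = cst 0) ?Rintegral_cst ?mul0r//;
      apply/funext => t; rewrite big_nil /dot /=; ring.
  move=> /andP[pq sb].
  rewrite (_ : lincomb _ _ = fun t => c * refsys b (m, (p, q)) t + lincomb (refsys b) s t).
    rewrite ipDl; [|exact: L2Z|exact: L2_lincomb|exact: L2_chi].
    rewrite (IH sb) addr0 refsysE ip_tfshift_chi//; apply: contraNneq pq; rewrite (ord1 m) (ord1 n).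
    by case: (b) => -[-> ->].
  by apply/funext => t; rewrite /lincomb big_cons.
have Ls : L2 (lincomb (refsys b) s) by exact: L2_lincomb.
have hc : ip (csub chi (lincomb (refsys b) s)) chi = 1.
  rewrite (_ : csub _ _ = fun t => chi t + (((-1)%:C)%C * lincomb (refsys b) s t)).
    rewrite ipDl; [|exact: L2_chi|exact: L2Z|exact: L2_chi].
    by rewrite ipZl ?h0 ?mulr0 ?addr0 ?ip_chi_chi//; exact: L2_chi.
  by apply/funext => t; rewrite /csub rmorphN mulN1r.
have Lc : L2 (csub chi (lincomb (refsys b) s)) by apply: L2B => //; exact: L2_chi.
have := cauchy_schwarz (@L2ipDl R) (@L2ipZl R) (@L2ipC R) (@L2ip_ge0 R)
  (toL2 Lc) (toL2 L2_chi).
rewrite /L2ip /= hc ip_chi_chi mulr1 expr1n => h1.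
by rewrite L2normE -(@sqrtr1 R) ler_sqrt// ip_ge0.
Qed.

End ReferenceSystem.

(** * Completeness of the reference system *)

Section ReferenceComplete.
Variable R : realType.
Local Notation C := R[i].
Local Notation mu := (@lebesgue_measure R).

Definition refatom (kl : int * int) : cfun R := tfshift (@chi R) kl.1%:~R kl.2%:~R.

Definition refspan (f : cfun R) := in_span refatom f.

Lemma L2_refspan f : refspan f -> L2 f.
Proof. by move=> [s ->]; apply: L2_lincomb => i; apply: L2_tfshift; exact: L2_chi. Qed.

Lemma refspanD f h : refspan f -> refspan h -> refspan (fun t => f t + h t).
Proof.
by move=> [s ->] [s' ->]; exists (s ++ s'); apply/funext => t; rewrite lincomb_cat.
Qed.

Lemma refspanZ c f : refspan f -> refspan (fun t => c * f t).
Proof.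
by move=> [s ->]; eexists; apply/funext => t; rewrite -lincomb_scale.
Qed.

(** Modulation by an integer frequency permutes the atoms, so the multipliers contain all
    trigonometric polynomials of period 1. They form an algebra, which gives access to polynomials
    in such functions. *)
Definition multiplier (P : cfun R) := forall h, refspan h -> refspan (fun t => P t * h t).

Lemma multiplier_cst c : multiplier (fun=> c).
Proof. by move=> h; exact: refspanZ. Qed.

Lemma multiplierD P Q : multiplier P -> multiplier Q -> multiplier (fun t => P t + Q t).
Proof.
move=> mP mQ h rh; have := refspanD (mP _ rh) (mQ _ rh).
by congr refspan; apply/funext => t; rewrite mulrDl.
Qed.

Lemma multiplierM P Q : multiplier P -> multiplier Q -> multiplier (fun t => P t * Q t).
Proof.
move=> mP mQ h rh; have := mP _ (mQ _ rh).
by congr refspan; apply/funext => t; rewrite mulrA.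
Qed.

Lemma multiplierX P n : multiplier P -> multiplier (fun t => P t ^+ n).
Proof.
move=> mP; elim: n => [|n IH]; first exact: multiplier_cst.
have := multiplierM mP IH.
by congr multiplier; apply/funext => t; rewrite exprS.
Qed.

Lemma multiplier_expi (l : int) : multiplier (fun t => expi (2 * pi * l%:~R * t)).
Proof.
move=> _ [s ->].
rewrite (_ : (fun t => _) =
  lincomb (fun kl t => expi (2 * pi * l%:~R * t) * refatom kl t) s); last first.
  by apply/funext => t; rewrite /lincomb mulr_sumr; apply: eq_bigr => p _; rewrite mulrCA.
exists [seq (p.1 * 1, (p.2.1, p.2.2 + l)) | p <- s].
apply: (lincomb_map (sh := fun kl => (kl.1, kl.2 + l)) (ph := fun=> 1)) => kl t.
rewrite mul1r /refatom /tfshift /= mulrA -expiD; congr (expi _ * _).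
by rewrite rmorphD /=; ring.
Qed.

Lemma cos_expi (th : R) : ((cos th)%:C)%C = 2^-1 * (expi th + expi (- th)).
Proof.
have -> : expi th + expi (- th) = ((cos th + cos th)%:C)%C.
  by rewrite /expi cosN sinN; apply/eqP; rewrite eq_complex /= subrr !eqxx.
by rewrite rmorphD /=; field.
Qed.

Lemma multiplier_cos (c : R) : multiplier (fun t => ((cos (2 * pi * t + c))%:C)%C).
Proof.
have m1 := multiplierM (multiplier_cst (expi c)) (multiplier_expi 1).
have m2 := multiplierM (multiplier_cst (expi (- c))) (multiplier_expi (-1)).
have := multiplierM (multiplier_cst 2^-1) (multiplierD m1 m2).
congr multiplier; apply/funext => t; rewrite cos_expi; congr (_ * (_ + _)).
  by rewrite -expiD mulr1 addrC.
by rewrite -expiD rmorphN /= mulrN1 opprD addrC; congr (expi (_ - _)); ring.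
Qed.

Variable k : int.

(* Positive exactly where t > x, for t in ]k, k + 1[ and x in [k, k + 1]. *)
Definition sgn_trig (x t : R) : R := sin (pi * (t - x)) * sin (pi * (t - k%:~R)).

(** Each sine alone has frequency 1/2, but their product is (cos(pi (x - k)) - cos(2 pi t - pi (x +
    k))) / 2, of period 1. *)
Lemma multiplier_sgn_trig x : multiplier (fun t => ((sgn_trig x t)%:C)%C).
Proof.
have m1 := multiplier_cst ((cos (pi * (x - k%:~R)) / 2)%:C)%C.
have m2 := multiplierM (multiplier_cst ((- 2^-1)%:C)%C) (multiplier_cos (- (pi * (x + k%:~R)))).
have := multiplierD m1 m2; congr multiplier; apply/funext => t.
rewrite -rmorphM -rmorphD; apply: (congr1 (fun z : R => (z%:C)%C)).
rewrite /sgn_trig.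
rewrite (_ : pi * (x - k%:~R) = pi * (t - k%:~R) - pi * (t - x)); last by ring.
rewrite (_ : 2 * pi * t + _ = pi * (t - k%:~R) + pi * (t - x)); last by ring.
by rewrite cosB cosD; field.
Qed.

Lemma sgn_trig_itv x t : -1 <= sgn_trig x t <= 1.
Proof.
rewrite -ler_norml normrM -(mulr1 1); apply: ler_pM => //; rewrite ler_norml;
  by rewrite sin_geN1 sin_le1.
Qed.

(** Maps the sign of [sgn_trig] to a position relative to 1/2 in [0, 1], with order reversed, so
    that [step_poly] tends to 1 on the side t > x. *)
Definition half_trig (x t : R) : R := (1 - sgn_trig x t) / 2.

Lemma half_trig_itv x t : 0 <= half_trig x t <= 1.
Proof. by have /andP[] := sgn_trig_itv x t; rewrite /half_trig => *; apply/andP; split; lra. Qed.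

(* These polynomials in y tend to 1 for y < 1/2 and to 0 for 1/2 < y <= 1. *)
Definition step_poly (n : nat) (y : R) : R := (1 - y ^+ n) ^+ (2 ^ n).

(** Applied, like the next bound, with a = y^n and m = 2^n: then m a = (2y)^n, which tends to 0 or
    to infinity according to the side of 1/2. *)
Lemma bernoulli_le (m : nat) (a : R) : 0 <= a <= 1 -> 1 - a *+ m <= (1 - a) ^+ m.
Proof.
move=> /andP[a0 a1]; elim: m => [|m IH]; first by rewrite mulr0n subr0 expr0.
rewrite exprS mulrSr.
have a2 : 0 <= 1 - a by rewrite subr_ge0.
apply: le_trans (ler_wpM2l a2 IH).
have : 0 <= a * (a *+ m) by rewrite mulr_ge0// mulrn_wge0.
lra.
Qed.

Lemma bernoulli_ge (m : nat) (a : R) : 0 <= a <= 1 -> (1 - a) ^+ m * (1 + a *+ m) <= 1.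
Proof.
move=> /andP[a0 a1]; elim: m => [|m IH]; first by rewrite mulr0n addr0 expr0 mulr1.
apply: le_trans IH; rewrite exprSr -mulrA ler_wpM2l ?exprn_ge0 ?subr_ge0//.
rewrite mulrSr; have am : 0 <= a *+ m by rewrite mulrn_wge0.
have : 0 <= a * (a *+ m) by rewrite mulr_ge0.
have : 0 <= a * a by rewrite mulr_ge0.
lra.
Qed.

Lemma step_poly_itv n y : 0 <= y <= 1 -> 0 <= step_poly n y <= 1.
Proof.
move=> /andP[y0 y1]; have yn : 0 <= y ^+ n <= 1 by rewrite exprn_ge0//= exprn_ile1.
case/andP: yn => yn0 yn1.
by rewrite exprn_ge0 ?subr_ge0//= exprn_ile1 ?subr_ge0// lerBlDr lerDl.
Qed.

Lemma step_poly_cvg1 y : 0 <= y < 2^-1 -> step_poly ^~ y @ \oo --> (1 : R).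
Proof.
move=> /andP[y0 y1].
have y1' : 0 <= y <= 1 by rewrite y0; lra.
apply: (@squeeze_cvgr _ _ _ _ (fun n => 1 - (2 * y) ^+ n) (fun=> 1)).
- near=> n; rewrite (andP (step_poly_itv n y1')).2 andbT.
  have yn : 0 <= y ^+ n <= 1 by case/andP: y1' => *; rewrite exprn_ge0//= exprn_ile1.
  apply: le_trans (bernoulli_le (2 ^ n) yn).
  by rewrite exprMn -natrX mulr_natl.
- rewrite -[X in _ --> X]subr0; apply: cvgB; first exact: cvg_cst.
  by apply: cvg_expr; rewrite ger0_norm ?mulr_ge0//; lra.
- exact: cvg_cst.
Unshelve. all: by end_near. Qed.

Lemma step_poly_cvg0 y : 2^-1 < y <= 1 -> step_poly ^~ y @ \oo --> (0 : R).
Proof.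
move=> /andP[y1 y2].
have y1' : 0 <= y <= 1 by rewrite y2; lra.
have yp : 0 < 2 * y by lra.
apply: (@squeeze_cvgr _ _ _ _ (fun=> 0) (fun n => (2 * y)^-1 ^+ n)).
- near=> n; rewrite (andP (step_poly_itv n y1')).1 /=.
  have yn : 0 <= y ^+ n <= 1 by case/andP: y1' => *; rewrite exprn_ge0//= exprn_ile1.
  have := bernoulli_ge (2 ^ n) yn.
  rewrite exprVn exprMn -[_ *+ (2 ^ n)%N]mulr_natl natrX => h.
  have p : 0 < 2 ^+ n * y ^+ n by rewrite -exprMn exprn_gt0.
  rewrite -[leRHS]mul1r ler_pdivlMr//; apply: le_trans h.
  by rewrite ler_wpM2l ?(andP (step_poly_itv n y1')).1// lerDr.
- exact: cvg_cst.
- apply: cvg_expr; rewrite ger0_norm ?invr_ge0 ?ltW//.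
  by rewrite invf_lt1//; lra.
Unshelve. all: by end_near. Qed.

Lemma half_trig_lt x t : k%:~R < t < k%:~R + 1 -> k%:~R <= x <= k%:~R + 1 ->
  (x < t -> 0 <= half_trig x t < 2^-1) /\ (t < x -> 2^-1 < half_trig x t <= 1).
Proof.
move=> /andP[t0 t1] /andP[x0 x1].
have p0 : 0 < (pi : R) := pi_gt0 R.
have s2 : 0 < sin (pi * (t - k%:~R)).
  apply: sin_gt0_pi; rewrite mulr_gt0 ?subr_gt0//=.
  by rewrite -[ltRHS]mulr1 ltr_pM2l//; lra.
have /andP[h0 h1] := half_trig_itv x t.
split=> xt.
  have s1 : 0 < sin (pi * (t - x)).
    apply: sin_gt0_pi; rewrite mulr_gt0 ?subr_gt0//=.
    by rewrite -[ltRHS]mulr1 ltr_pM2l//; lra.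
  have := mulr_gt0 s1 s2; rewrite h0 /half_trig /sgn_trig /=; lra.
have s1 : 0 < sin (pi * (x - t)).
  apply: sin_gt0_pi; rewrite mulr_gt0 ?subr_gt0//=.
  by rewrite -[ltRHS]mulr1 ltr_pM2l//; lra.
have := mulr_gt0 s1 s2; rewrite h1 andbT /half_trig /sgn_trig.
rewrite -(opprB t x) mulrN sinN; lra.
Qed.

End ReferenceComplete.

(** * Closure of the reference span: rays, then measurable sets, inside one cell *)

Section ReferenceDense.
Variable R : realType.
Local Notation C := R[i].
Local Notation mu := (@lebesgue_measure R).

Definition refclosure (f : cfun R) := L2 f /\
  forall eps : R, 0 < eps -> exists h, refspan h /\ L2norm (csub f h) < eps.

Lemma refclosure_lim (f : cfun R) : L2 f ->
  (forall eps : R, 0 < eps -> exists h, refclosure h /\ L2norm (csub f h) < eps) ->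
  refclosure f.
Proof.
move=> Lf H; split => // eps e0.
have e2 : 0 < eps / 2 by rewrite divr_gt0.
have [h [[Lh hc] fh]] := H _ e2.
have [s [rs hs]] := hc _ e2; exists s; split => //.
rewrite (_ : csub f s = fun t => csub f h t + csub h s t).
  apply: le_lt_trans (L2normD _ _) _; [exact: L2B|apply: L2B => //; exact: L2_refspan|].
  by rewrite [ltRHS]splitr ltrD.
by apply/funext => t; rewrite /csub addrA subrK.
Qed.

Lemma refclosure_span f : refspan f -> refclosure f.
Proof.
move=> rf; split; first exact: L2_refspan.
move=> eps e0; exists f; split => //.
rewrite (_ : csub f f = fun t => 0 * f t).
  by rewrite L2normZ ?sqmod0 ?sqrtr0 ?mul0r//; exact: L2_refspan.
by apply/funext => t; rewrite /csub subrr mul0r.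
Qed.

Lemma refclosureD f h : refclosure f -> refclosure h -> refclosure (fun t => f t + h t).
Proof.
move=> [Lf cf] [Lh ch]; split; first exact: L2D.
move=> eps e0; have e2 : 0 < eps / 2 by rewrite divr_gt0.
have [f' [rf ff]] := cf _ e2; have [h' [rh hh]] := ch _ e2.
exists (fun t => f' t + h' t); split; first exact: refspanD.
rewrite (_ : csub _ _ = fun t => csub f f' t + csub h h' t).
  apply: le_lt_trans (L2normD _ _) _; [exact/L2B/L2_refspan|exact/L2B/L2_refspan|].
  by rewrite [ltRHS]splitr ltrD.
by apply/funext => t; rewrite /csub opprD addrACA.
Qed.

Lemma refclosureZ c f : refclosure f -> refclosure (fun t => c * f t).
Proof.
move=> [Lf cf]; split; first exact: L2Z.
move=> eps e0; have c0 : 0 < Num.sqrt (sqmod c) + 1 by rewrite ltr_wpDl ?sqrtr_ge0.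
have [f' [rf ff]] := cf _ (divr_gt0 e0 c0).
exists (fun t => c * f' t); split; first exact: refspanZ.
rewrite (_ : csub _ _ = fun t => c * csub f f' t).
  rewrite L2normZ; last exact/L2B/L2_refspan.
  apply: (@le_lt_trans _ _ ((Num.sqrt (sqmod c) + 1) * L2norm (csub f f'))).
    by rewrite ler_wpM2r ?L2norm_ge0// lerDl.
  by rewrite mulrC -ltr_pdivlMr.
by apply/funext => t; rewrite /csub mulrBr.
Qed.

Local Notation real_cfun f := (fun t : R => ((f t : R)%:C)%C).

Definition refclosureR (f : R -> R) := refclosure (real_cfun f).

Lemma refclosureRD f h : refclosureR f -> refclosureR h ->
  refclosureR (fun t => f t + h t).
Proof.
move=> cf ch; have := refclosureD cf ch.
by congr refclosure; apply/funext => t; rewrite rmorphD.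
Qed.

Lemma refclosureRZ c f : refclosureR f -> refclosureR (fun t => c * f t).
Proof.
move=> cf; have := refclosureZ (c%:C)%C cf.
by congr refclosure; apply/funext => t; rewrite rmorphM.
Qed.

Lemma refclosureR0 : refclosureR (fun=> 0).
Proof. by apply: refclosure_span; exists [::]; apply/funext => t; rewrite /lincomb big_nil. Qed.

Lemma refclosureRB f h : refclosureR f -> refclosureR h ->
  refclosureR (fun t => f t - h t).
Proof.
move=> cf ch; have := refclosureRD cf (refclosureRZ (-1) ch).
by congr refclosureR; apply/funext => t; rewrite mulN1r.
Qed.

Lemma refclosureR_dominated (f : nat -> R -> R) (h G : R -> R) :
  (forall n, refclosureR (f n)) -> measurable_fun setT h ->
  (forall t, `|h t| <= `|G t|) -> L2 (real_cfun G) ->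
  (forall n t, `|f n t| <= `|G t|) ->
  {ae mu, forall t, (fun n => f n t) @ \oo --> h t} -> refclosureR h.
Proof.
move=> cf mh hG LG fG fh.
have sq (a b : R) : `|a| <= `|b| -> sqmod ((a%:C)%C) <= sqmod ((b%:C)%C).
  by rewrite !sqmod_real -(real_normK (num_real a)) -(real_normK (num_real b)) => ab;
    rewrite ler_pXn2r ?nnegrE.
have Lh : L2 (real_cfun h).
  apply: (L2_le (h := real_cfun G) (k := 1)) => //.
  by move=> t; rewrite mul1r; exact: sq.
apply: refclosure_lim => // eps e0.
have [|||n hn] := L2_dominated (f := fun n => real_cfun (f n)) _ Lh LG _ _ e0.
- by move=> n; case: (cf n) => -[].
- by move=> n t; exact: sq.
- apply: negligibleS fh => t /= nF cF; apply: nF; split => //.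
  exact: cvg_cst.
by exists (real_cfun (f n)); split; [exact: cf|].
Qed.

Definition cell (k : int) (t : R) : R := ((0 <= t - k%:~R < 1)%R)%:R.

Lemma refatom_cell k t : @refatom R (k, 0) t = ((cell k t)%:C)%C.
Proof.
rewrite /refatom /tfshift /= mulr0z mulr0 mul0r expi0 mul1r /chi /cell.
by case: (0 <= t - _ < 1).
Qed.

Lemma refspan_atom kl : refspan (@refatom R kl).
Proof. by exists [:: (1, kl)]; apply/funext => t; rewrite /lincomb big_seq1 mul1r. Qed.

Lemma refclosureR_cell k : refclosureR (cell k).
Proof.
have := refclosure_span (refspan_atom (k, 0)).
by congr refclosure; apply/funext => t; rewrite refatom_cell.
Qed.

Lemma cell01 k t : 0 <= cell k t <= 1.
Proof. by rewrite /cell; case: (0 <= t - _ < 1) => /=; rewrite ?ler01 ?lexx. Qed.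

Lemma measurable_cell k : measurable_fun setT (cell k).
Proof.
rewrite (_ : cell k = \1_(`[k%:~R, k%:~R + 1[%classic)); first exact: measurable_indic.
apply/funext => t; rewrite indicE mem_setE in_itv /= /cell.
by rewrite subr_ge0 ltrBlDl.
Qed.

Lemma ae_except2 (a b : R) (P : R -> Prop) :
  (forall t, t != a -> t != b -> P t) -> {ae mu, forall t, P t}.
Proof.
move=> H.
have neg c : mu.-negligible [set c].
  by exists [set c]; split => //; exact: lebesgue_measure_set1.
apply: negligibleS (negligibleU (neg a) (neg b)) => t /= nP.
have [->|ta] := eqVneq t a; first by left.
have [->|tb] := eqVneq t b; first by right.
by exfalso; exact/nP/H.
Qed.

(** When x lies in [k, k + 1], the functions [step_poly n (half_trig k x t)] are trigonometric
    polynomials in t, hence multipliers; on the cell they converge almost everywhere to the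
    indicator of the ray. Other x give the whole cell or 0. *)
Lemma refclosureR_ray k (x : R) :
  refclosureR (fun t => \1_(`]x, +oo[%classic) t * cell k t).
Proof.
have ind t : \1_(`]x, +oo[%classic) t = ((x < t)%R)%:R :> R.
  by rewrite indicE mem_setE in_itv /= andbT.
have [xk|xk] := ltP x k%:~R.
  have := refclosureR_cell k; congr refclosureR; apply/funext => t; rewrite ind /cell.
  by case: (boolP (0 <= t - _ < 1)) => [/andP[t0 _]|]; rewrite ?mulr0// mulr1 (_ : x < t)//; lra.
have [kx|kx] := ltP (k%:~R + 1) x.
  have := refclosureR0; congr refclosureR; apply/funext => t; rewrite ind /cell.
  case: (boolP (0 <= t - _ < 1)) => [/andP[_ t0]|]; rewrite ?mulr0// mulr1.
  by case: ltP => //; lra.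
pose f n t := step_poly n (half_trig k x t) * cell k t.
have fc n : refclosureR (f n).
  apply: refclosure_span.
  have m1 := multiplierM (multiplier_cst ((2^-1)%:C)%C) (multiplier_sgn_trig k x).
  have m2 := multiplierD (multiplier_cst ((2^-1)%:C)%C)
    (multiplierM (multiplier_cst ((-1)%:C)%C) m1).
  have m3 := multiplierD (multiplier_cst (1%:C)%C)
    (multiplierM (multiplier_cst ((-1)%:C)%C) (multiplierX n m2)).
  have := multiplierX (2 ^ n)%N m3 (refspan_atom (k, 0)).
  congr refspan; apply/funext => t; rewrite refatom_cell.
  rewrite -!(rmorphM, rmorphD, rmorphXn); apply: (congr1 (fun z : R => (z%:C)%C)).
  rewrite /f /step_poly /half_trig; congr (_ ^+ _ * _).
  by rewrite mulN1r; congr (_ - _ ^+ _); field.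
apply: (refclosureR_dominated (G := cell k) fc).
- by apply: measurable_funM; [exact: measurable_indic|exact: measurable_cell].
- move=> t; rewrite ind normrM ler_piMl//.
  by case: (x < t); rewrite ?normr1 ?normr0.
- by have [] := refclosureR_cell k.
- move=> n t; rewrite /f normrM ler_piMl//.
  by have /andP[h0 h1] := step_poly_itv n (half_trig_itv k x t); rewrite ger0_norm.
(* At t = k and at t = x [half_trig] equals 1/2, where the step polynomials tend to neither 0 nor
   1. *)
apply: (@ae_except2 k%:~R x) => t tk tx.
rewrite ind /f.
have [tt|tt] := boolP (k%:~R < t < k%:~R + 1); last first.
  rewrite (_ : cell k t = 0).
    by rewrite mulr0; under eq_fun do rewrite mulr0; exact: cvg_cst.
  rewrite /cell; case: (boolP (0 <= t - _ < 1)) => // /andP[t0 t1].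
  by case/negP: tt; rewrite lt_neqAle eq_sym tk/=; apply/andP; split; lra.
apply: cvgM; last exact: cvg_cst.
have [h1 h2] := half_trig_lt tt (introT andP (conj xk kx)).
have [xt|tx'] := ltP x t; first exact: step_poly_cvg1 (h1 xt).
by apply: step_poly_cvg0; apply: h2; rewrite lt_neqAle tx.
Qed.

(** Dynkin's pi-lambda theorem: open rays are stable under intersection and generate the Borel sets.
    The factor [cell k] keeps the functions in L2 and is the majorant for countable disjoint
    unions. *)
Lemma refclosureR_set k (A : set R) : measurable A ->
  refclosureR (fun t => \1_A t * cell k t).
Proof.
have L2cell : L2 (real_cfun (cell k)) by case: (refclosureR_cell k).
have dom (B : set R) t : `|\1_B t * cell k t| <= `|cell k t|.
  rewrite normrM ler_piMl// indicE; case: (t \in B); by rewrite ?normr1 ?normr0.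
have mind (B : set R) : measurable B -> measurable_fun setT (fun t => \1_B t * cell k t).
  by move=> mB; apply: measurable_funM; [exact: measurable_indic|exact: measurable_cell].
have mE := RGenOInfty.measurableE R.
move=> mA.
apply: (@dynkin_induction _ (measurableTypeR R) (@RGenOInfty.G R)
  (fun A => refclosureR (fun t => \1_A t * cell k t)) mE) => //.
- move=> _ _ [x ->] [y ->]; exists (Num.max x y).
  by apply/seteqP; split=> t /=; rewrite !in_itv/= !andbT gt_max => /andP.
- have := refclosureR_cell k; congr refclosureR; apply/funext => t.
  by rewrite indicE in_setT mul1r.
- by move=> _ [x ->]; exact: refclosureR_ray.
- move=> S mS cS; have := refclosureRB (refclosureR_cell k) cS.
  congr refclosureR; apply/funext => t; rewrite !indicE in_setC.
  by case: (t \in S) => /=; rewrite ?mul1r ?mul0r ?subr0 ?subrr.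
- move=> F mF tF cF.
  pose S n := \big[setU/set0]_(i < n) F i.
  have cS n : refclosureR (fun t => \1_(S n) t * cell k t).
    elim: n => [|n IH].
      rewrite /S big_ord0; have := refclosureR0; congr refclosureR.
      by apply/funext => t; rewrite indicE in_set0 mul0r.
    have := refclosureRD IH (cF n); congr refclosureR; apply/funext => t.
    rewrite -mulrDl /S big_ord_recr /=; congr (_ * _).
    rewrite !indicE in_setU; case: (boolP (t \in F n)) => Fn; last by rewrite addr0 orbF.
    case: (boolP (t \in _)) => [|_]; last by rewrite add0r.
    rewrite inE -bigcup_mkord => -[i /= ni Fi]; exfalso.
    have /(_ I I) := tF i n; move/set_mem : Fn => Fn ini.
    by move: ni; rewrite ini ?ltnn//; exists t.
  apply: (refclosureR_dominated (G := cell k) cS) => //.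
    by apply: mind; exact: bigcupT_measurable.
  apply: aeW => t; apply: cvgM; last exact: cvg_cst.
  rewrite indicE; case: (boolP (t \in _)) => [|/negP tF'].
    rewrite inE => -[n _ Fnt].
    apply: cvg_near_cst; exists n.+1 => // m /= nm.
    rewrite indicE mem_set// /S -bigcup_mkord; exists n => //=.
  apply: cvg_near_cst; near=> m.
  rewrite indicE memNset// /S -bigcup_mkord => -[n _ Fnt].
  by apply: tF'; rewrite inE; exists n.
have transfer (X Y : set (set R)) : X = Y -> X A -> Y A by move->.
exact: (transfer _ _ mE mA).
Unshelve. all: by end_near. Qed.

End ReferenceDense.

(** * Closure of the reference span: from simple functions to all of L2 *)

Section ReferenceDense2.
Variable R : realType.
Local Notation C := R[i].
Local Notation mu := (@lebesgue_measure R).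
Local Notation real_cfun f := (fun t : R => ((f t : R)%:C)%C).

Lemma refclosureR_sum (I : Type) (r : seq I) (F : I -> R -> R) :
  (forall i, refclosureR (F i)) -> refclosureR (fun t => \sum_(i <- r) F i t).
Proof.
move=> cF; elim: r => [|i r IH].
  by have := refclosureR0 R; congr refclosureR; apply/funext => t; rewrite big_nil.
have := refclosureRD (cF i) IH; congr refclosureR.
by apply/funext => t; rewrite big_cons.
Qed.

Lemma L2_real_le (f G : R -> R) : measurable_fun setT f -> L2 (real_cfun G) ->
  (forall t, `|f t| <= `|G t|) -> L2 (real_cfun f).
Proof.
move=> mf LG fG; apply: (L2_le (h := real_cfun G) (k := 1)) => //.
move=> t; rewrite mul1r !sqmod_real -(real_normK (num_real (f t))).
by rewrite -(real_normK (num_real (G t))) ler_pXn2r ?nnegrE.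
Qed.

Import HBNNSimple.

(** The simple approximations of f are finite combinations of indicators covered by
    [refclosureR_set], and f dominates them. *)
Lemma refclosureR_ge0_cell k (f : R -> R) : measurable_fun setT f ->
  L2 (real_cfun f) -> (forall t, 0 <= f t) -> refclosureR (fun t => f t * cell k t).
Proof.
move=> mf Lf f0.
have mf' : measurable_fun [set: measurableTypeR R] (EFin \o f) by apply/measurable_EFinP.
pose a n := nnsfun_approx measurableT mf' n.
have ac n : refclosureR (fun t => a n t * cell k t).
  have cs (y : R) : refclosureR (fun t => y * (\1_(a n @^-1` [set y]) t * cell k t)).
    by apply: refclosureRZ; apply: refclosureR_set; exact: (measurable_funPTI (a n) (measurable_set1 y)).
  have := refclosureR_sum (finmap.enum_fset (fset_set (range (a n)))) cs.
  congr refclosureR; apply/funext => t.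
  rewrite [a n t]fimfunE fsbig_finite//= mulr_suml.
  by apply: eq_bigr => y _; rewrite mulrA.
have ale n t : 0 <= a n t <= f t.
  rewrite fun_ge0 /= -lee_fin /a nnsfun_approxE.
  by apply: (@le_approx _ _ _ setT (EFin \o f)) => // s _; rewrite lee_fin.
have dom t (y : R) : 0 <= y <= f t -> `|y * cell k t| <= `|f t|.
  move=> /andP[y0 yf]; have /andP[c0 c1] := cell01 k t.
  rewrite !ger0_norm ?mulr_ge0//.
  by apply: le_trans yf; rewrite ler_piMr.
apply: (refclosureR_dominated (G := f) ac) => //.
- by apply: measurable_funM => //; exact: measurable_cell.
- by move=> t; apply: dom; rewrite f0 lexx.
- by move=> n t; exact/dom/ale.
apply: aeW => t; apply: cvgM; last exact: cvg_cst.
have f0' s : setT s -> (0%:E <= (EFin \o f) s)%E by rewrite lee_fin.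
by have /fine_cvgP[_] := cvg_nnsfun_approx measurableT mf' f0' (x := t) I.
Qed.

Lemma cellE k (t : R) : cell k t = ((k%:~R <= t < k%:~R + 1)%R)%:R.
Proof. by rewrite /cell subr_ge0 ltrBlDl. Qed.
(** The cell of index -i - 1 is [-i - 1, -i[, placed opposite to [i, i + 1[, so partial sums remain
    indicators of a single interval growing in both directions. *)
Lemma sum_cells n t :
  \sum_(i < n) (cell i%:Z t + cell (- i%:Z - 1) t) =
  ((- (n%:R : R) <= t < n%:R)%R)%:R.
Proof.
elim: n => [|n IH]; first by rewrite big_ord0 oppr0; case: ltgtP.
rewrite big_ord_recr /= IH !cellE rmorphB rmorphN /= subrK -natr1 opprD -pmulrn.
have := ler0n R n; move: (n%:R : R) => r r0.
have [h1|h1] := lerP (- r) t; have [h2|h2] := ltP t r;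
have [h3|h3] := lerP (- r - 1) t; have [h4|h4] := ltP t (r + 1);
by rewrite /= ?addr0 ?add0r //; lra.
Qed.

Lemma refclosureR_ge0 (f : R -> R) : measurable_fun setT f ->
  L2 (real_cfun f) -> (forall t, 0 <= f t) -> refclosureR f.
Proof.
move=> mf Lf f0.
pose S n t := f t * \sum_(i < n) (cell i%:Z t + cell (- i%:Z - 1) t).
have cS n : refclosureR (S n).
  have := refclosureR_sum (index_enum 'I_n) (fun i : 'I_n =>
    refclosureRD (refclosureR_ge0_cell i%:Z mf Lf f0)
                 (refclosureR_ge0_cell (- i%:Z - 1) mf Lf f0)).
  congr refclosureR; apply/funext => t; rewrite /S mulr_sumr.
  by apply: eq_bigr => i _; rewrite mulrDr.
apply: (refclosureR_dominated (G := f) cS) => //.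
  move=> n t; rewrite /S sum_cells normrM ler_piMr//.
  by case: (_ && _); rewrite ?normr1 ?normr0.
apply: aeW => t; apply: cvg_near_cst; near=> n.
rewrite /S sum_cells (_ : (_ && _) = true) ?mulr1//.
have : `|t| < n%:R by near: n; exact: nbhs_infty_gtr.
by rewrite ltr_norml => /andP[h1 h2]; rewrite h2 ltW.
Unshelve. all: by end_near. Qed.

Lemma refclosureR_L2 (f : R -> R) : measurable_fun setT f ->
  L2 (real_cfun f) -> refclosureR f.
Proof.
move=> mf Lf.
have mN : measurable_fun setT (fun t => - f t) by exact: measurableT_comp.
have mp : measurable_fun setT (fun t => Num.max (f t) 0) by exact: measurable_maxr.
have mn : measurable_fun setT (fun t => Num.max (- f t) 0) by exact: measurable_maxr.
have Lp : L2 (real_cfun (fun t => Num.max (f t) 0)).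
  by apply: L2_real_le Lf _ => // t; case: (lerP (f t) 0); rewrite ?normr0.
have Ln : L2 (real_cfun (fun t => Num.max (- f t) 0)).
  by apply: L2_real_le Lf _ => // t; case: (lerP (- f t) 0); rewrite ?normr0 ?normrN.
have pos (y : R) : 0 <= Num.max y 0 by rewrite le_max lexx orbT.
have := refclosureRB (refclosureR_ge0 mp Lp (fun t => pos _))
                     (refclosureR_ge0 mn Ln (fun t => pos _)).
congr refclosureR; apply/funext => t.
case: (lerP (f t) 0) => h; case: (lerP (- f t) 0) => h'; lra.
Qed.

Lemma refclosure_L2 (f : cfun R) : L2 f -> refclosure f.
Proof.
move=> Lf; have [[mRe mIm] _] := Lf.
have LRe : L2 (real_cfun (fun t => complex.Re (f t))).
  apply: (L2_le (h := f) (k := 1)) => //.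
  by move=> t; rewrite mul1r sqmod_real lerDl sqr_ge0.
have LIm : L2 (real_cfun (fun t => complex.Im (f t))).
  apply: (L2_le (h := f) (k := 1)) => //.
  by move=> t; rewrite mul1r sqmod_real lerDr sqr_ge0.
have := refclosureD (refclosureR_L2 mRe LRe) (refclosureZ 'i%C (refclosureR_L2 mIm LIm)).
by congr refclosure; apply/funext => t; rewrite -complexE.
Qed.

Lemma refsys_complete b : complete_system (@refsys R b).
Proof.
move=> f /refclosure_L2[_ cf] eps e0; have [_ [[s ->] hs]] := cf _ e0.
exists (lincomb (@refatom R) s); split => //.
pose sh (kl : int * int) : 'I_1 * (int * int) := (ord0, if b then kl else (kl.2, kl.1)).
exists [seq (p.1 * 1, sh p.2) | p <- s].
apply: (lincomb_map (sh := sh) (ph := fun=> 1)) => kl t.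
by rewrite mul1r (surjective_pairing (sh kl))
  (surjective_pairing (sh kl).2) refsysE /sh; case: kl => k l; case: (b).
Qed.

End ReferenceDense2.

(** * Homogeneous approximation *)

Section ChiOrbit.
Variable R : realType.
Local Notation C := R[i].
Local Notation mu := (@lebesgue_measure R).

Lemma L2_indic_itv (a b : R) : L2 (fun t : R => ((\1_(`[a, b]%classic) t : R)%:C)%C).
Proof.
split; first by apply: cmeasurable_real; exact: measurable_indic.
rewrite /sqnorm; under eq_integral => t _.
  rewrite -/(sqmod _) sqmod_real.
  rewrite (_ : _ ^+ 2 = \1_(`[a, b]%classic : set R) t); last first.
    by rewrite indicE; case: (t \in _); rewrite ?expr1n ?expr0n.
  over.
rewrite integral_indic// setIT; have := lebesgue_measure_itv `[a, b] => /= ->.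
by case: ifP; rewrite ?ltry// -EFinB ltry.
Qed.

Lemma chi_in t : 0 <= t < 1 -> @chi R t = 1.
Proof. by rewrite /chi => ->. Qed.
Lemma chi_lt0 t : t < 0 -> @chi R t = 0.
Proof. by rewrite /chi ltNge => /negPf ->. Qed.
Lemma chi_ge1 t : 1 <= t -> @chi R t = 0.
Proof. by rewrite /chi leNgt => /negPf ->; rewrite andbF. Qed.

Lemma Re_tfshift_chi a b t : complex.Re (tfshift (@chi R) a b t) =
  cos (2 * pi * b * t) * complex.Re (@chi R (t - a)).
Proof. by rewrite /tfshift complex_ReM /expi /= /chi;
  case: (_ && _) => /=; rewrite !mulr0 subr0. Qed.
Lemma Im_tfshift_chi a b t : complex.Im (tfshift (@chi R) a b t) =
  sin (2 * pi * b * t) * complex.Re (@chi R (t - a)).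
Proof. by rewrite /tfshift complex_ImM /expi /= /chi;
  case: (_ && _) => /=; rewrite !mulr0 add0r. Qed.

(** By contradiction along a sequence z n tending to z0, since [L2_dominated] is sequential. *)
Lemma tfshift_chi_continuous (z0 : R * R) (eps : R) : 0 < eps ->
  exists2 d : R, 0 < d & forall z : R * R, `|z.1 - z0.1| < d -> `|z.2 - z0.2| < d ->
    L2norm (csub (tfshift (@chi R) z0.1 z0.2) (tfshift (@chi R) z.1 z.2)) < eps.
Proof.
move=> e0; apply: contrapT => H.
have {}H (n : nat) : exists z : R * R, [/\ `|z.1 - z0.1| < n.+1%:R^-1,
    `|z.2 - z0.2| < n.+1%:R^-1 &
    eps <= L2norm (csub (tfshift (@chi R) z0.1 z0.2) (tfshift (@chi R) z.1 z.2))].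
  apply: contrapT => Hn; apply: H; exists n.+1%:R^-1; first by rewrite invr_gt0.
  move=> z z1 z2; rewrite ltNge; apply/negP => ez; apply: Hn.
  by exists z.
have [z zP] := choice H.
have z1 : (fun n => (z n).1) @ \oo --> z0.1.
  apply/cvgrPdist_lt => e e0'; near=> n; rewrite distrC.
  have [h _ _] := zP n; apply: lt_trans h _; near: n.
  exact: near_infty_natSinv_lt (PosNum e0').
have z2 : (fun n => (z n).2) @ \oo --> z0.2.
  apply/cvgrPdist_lt => e e0'; near=> n; rewrite distrC.
  have [_ h _] := zP n; apply: lt_trans h _; near: n.
  exact: near_infty_natSinv_lt (PosNum e0').
(* Since |(z n).1 - z0.1| < 1/(n + 1) <= 1, this interval contains the supports of all the shifts in
   the sequence. *)
pose G : cfun R := fun t : R => ((\1_(`[z0.1 - 1, z0.1 + 2]%classic) t : R)%:C)%C.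
have Ltf a b : L2 (tfshift (@chi R) a b) by apply: L2_tfshift; exact: L2_chi.
have [|||n hn] := L2_dominated (f := fun n => tfshift (@chi R) (z n).1 (z n).2)
  _ (Ltf z0.1 z0.2) (L2_indic_itv (z0.1 - 1) (z0.1 + 2)) _ _ e0.
- by move=> n; case: (Ltf (z n).1 (z n).2).
- move=> n t; rewrite sqmod_tfshift /chi sqmod_nat sqmod_real indicE mem_setE in_itv /=.
  have [h1 _ _] := zP n.
  have : (n.+1%:R^-1 : R) <= 1 by rewrite invf_le1// ler1n.
  move: h1; move: (n.+1%:R^-1 : R) => r; rewrite ltr_norml => /andP[h1 h2] h3.
  case: (boolP (0 <= t - _ < 1)) => [/andP[h4 h5]|_]; last by rewrite sqr_ge0.
  suff -> : z0.1 - 1 <= t <= z0.1 + 2 by rewrite expr1n.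
  by apply/andP; split; lra.
(* The excluded points are the jumps of the limit; elsewhere the translated [chi] is eventually
   constant in n and only the phase has to converge. *)
- apply: (@ae_except2 _ z0.1 (z0.1 + 1)) => t t0 t1.
  have cc : \forall n \near \oo, chi (t - (z n).1) = chi (t - z0.1).
    have [h|h] := ltP t z0.1.
      have : \forall n \near \oo, `|z0.1 - (z n).1| < z0.1 - t.
        by move/cvgrPdist_lt : z1; apply; rewrite subr_gt0.
      apply: filterS => n; rewrite ltr_norml => /andP[h1 h2].
      by rewrite !chi_lt0 ?subr_lt0//; lra.
    have {}h : z0.1 < t by rewrite lt_neqAle eq_sym t0.
    have [h'|h'] := ltP (z0.1 + 1) t.
      have : \forall n \near \oo, `|z0.1 - (z n).1| < t - (z0.1 + 1).
        by move/cvgrPdist_lt : z1; apply; rewrite subr_gt0.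
      apply: filterS => n; rewrite ltr_norml => /andP[h1 h2].
      by rewrite !chi_ge1//; lra.
    have {}h' : t < z0.1 + 1 by rewrite lt_neqAle t1.
    have : \forall n \near \oo, `|z0.1 - (z n).1| < Num.min (t - z0.1) (z0.1 + 1 - t).
      by move/cvgrPdist_lt : z1; apply; rewrite lt_min !subr_gt0 h h'.
    apply: filterS => n; rewrite lt_min !ltr_norml => /andP[/andP[h1 h2] /andP[h3 h4]].
    by rewrite !chi_in//; apply/andP; split; lra.
  have arg : (fun n => 2 * pi * (z n).2 * t) @ \oo --> 2 * pi * z0.2 * t.
    by apply: cvgM; [apply: cvgM => //; exact: cvg_cst|exact: cvg_cst].
  split.
    rewrite Re_tfshift_chi.
    apply: (@cvg_trans _ ((fun n => cos (2 * pi * (z n).2 * t) * complex.Re (@chi R (t - z0.1))) @ \oo)).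
      by apply: near_eq_cvg; apply: filterS cc => n cn; rewrite Re_tfshift_chi cn.
    apply: cvgM; last exact: cvg_cst.
    by apply: (cvg_comp _ _ arg); exact: continuous_cos.
  rewrite Im_tfshift_chi.
  apply: (@cvg_trans _ ((fun n => sin (2 * pi * (z n).2 * t) * complex.Re (@chi R (t - z0.1))) @ \oo)).
    by apply: near_eq_cvg; apply: filterS cc => n cn; rewrite Im_tfshift_chi cn.
  apply: cvgM; last exact: cvg_cst.
  by apply: (cvg_comp _ _ arg); exact: continuous_sin.
by have [_ _] := zP n; rewrite leNgt => /negP; apply.
Unshelve. all: by end_near. Qed.

End ChiOrbit.

(** * Uniform approximation of the orbit of a function by a complete system *)

Section Approximation.
Variables (R : realType) (N : nat) (g : 'I_N -> cfun R) (x : 'I_N -> R * R).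
Variables (v w : R * R).
Hypothesis Lg : forall n, L2 (g n).
Hypothesis vw : det2 v w != 0.
Local Notation C := R[i].
Local Notation E := (gabor_union g x v w).

(** With [coord2], Cramer's formulas for the coordinates of z in the basis (v, w). *)
Definition coord1 (z : R * R) : R := det2 z w / det2 v w.
Definition coord2 (z : R * R) : R := det2 v z / det2 v w.

(** The offset [x i.1] is left out: there are finitely many, so they change distances by a bounded
    amount. *)
Definition close_idx (rho : R) (z : R * R) (i : 'I_N * (int * int)) :=
  (`|i.2.1%:~R - coord1 z| <= rho) && (`|i.2.2%:~R - coord2 z| <= rho).

Definition approximable (eps rho : R) (f : cfun R) (z : R * R) :=
  exists s, all (fun c => close_idx rho z c.2) s /\
    L2norm (csub (tfshift f z.1 z.2) (lincomb E s)) < eps.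

(* Homogeneous approximation property: [rho] is chosen before [z]. *)
Definition hap (f : cfun R) := L2 f /\
  forall eps : R, 0 < eps -> exists rho, forall z, approximable eps rho f z.

Lemma close_idx_le rho rho' z i : rho <= rho' -> close_idx rho z i -> close_idx rho' z i.
Proof. by move=> rr /andP[h1 h2]; rewrite /close_idx (le_trans h1) ?(le_trans h2). Qed.

Let L2E s : L2 (lincomb E s).
Proof. by apply: L2_lincomb => i; exact: L2_gabor. Qed.

(** Shifts are isometries, so h stays close to f at every z simultaneously and a radius for h serves
    for f. *)
Lemma hap_lim f : L2 f ->
  (forall eps : R, 0 < eps -> exists h, hap h /\ L2norm (csub f h) < eps) -> hap f.
Proof.
move=> Lf H; split => // eps e0; have e2 : 0 < eps / 2 by rewrite divr_gt0.
have [h [[Lh hh] fh]] := H _ e2; have [rho rP] := hh _ e2.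
exists rho => z; have [s [sn sh]] := rP z; exists s; split => //.
rewrite (_ : csub _ _ = fun t => tfshift (csub f h) z.1 z.2 t +
    csub (tfshift h z.1 z.2) (lincomb E s) t).
  apply: le_lt_trans (L2normD _ _) _.
  - by apply: L2_tfshift; exact: L2B.
  - by apply: L2B => //; exact: L2_tfshift.
  by rewrite [ltRHS]splitr L2norm_tfshift ?ltrD//; exact: L2B.
by apply/funext => t; rewrite tfshiftB /csub addrA subrK.
Qed.

Lemma hapD f h : hap f -> hap h -> hap (fun t => f t + h t).
Proof.
move=> [Lf cf] [Lh ch]; split; first exact: L2D.
move=> eps e0; have e2 : 0 < eps / 2 by rewrite divr_gt0.
have [r1 rP1] := cf _ e2; have [r2 rP2] := ch _ e2.
exists (Num.max r1 r2) => z; have [s1 [sn1 sh1]] := rP1 z; have [s2 [sn2 sh2]] := rP2 z.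
exists (s1 ++ s2); split.
  rewrite all_cat; apply/andP; split.
    by apply: sub_all sn1 => c; apply: close_idx_le; rewrite le_max lexx.
  by apply: sub_all sn2 => c; apply: close_idx_le; rewrite le_max lexx orbT.
rewrite (_ : csub _ _ = fun t => csub (tfshift f z.1 z.2) (lincomb E s1) t +
    csub (tfshift h z.1 z.2) (lincomb E s2) t).
  apply: le_lt_trans (L2normD _ _) _; [by apply: L2B => //; exact: L2_tfshift..|].
  by rewrite [ltRHS]splitr ltrD.
by apply/funext => t; rewrite /csub lincomb_cat /tfshift mulrDr opprD addrACA.
Qed.

Lemma hapZ c f : hap f -> hap (fun t => c * f t).
Proof.
move=> [Lf cf]; split; first exact: L2Z.
move=> eps e0; have c0 : 0 < Num.sqrt (sqmod c) + 1 by rewrite ltr_wpDl ?sqrtr_ge0.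
have [r rP] := cf _ (divr_gt0 e0 c0); exists r => z; have [s [sn sh]] := rP z.
exists [seq (c * p.1, p.2) | p <- s]; split; first by rewrite all_map.
rewrite (_ : csub _ _ = fun t => c * csub (tfshift f z.1 z.2) (lincomb E s) t).
  rewrite L2normZ; last by apply: L2B => //; exact: L2_tfshift.
  apply: (@le_lt_trans _ _ ((Num.sqrt (sqmod c) + 1) *
      L2norm (csub (tfshift f z.1 z.2) (lincomb E s)))).
    by rewrite ler_wpM2r ?L2norm_ge0// lerDl.
  by rewrite mulrC -ltr_pdivlMr.
by apply/funext => t; rewrite /csub lincomb_scale /tfshift mulrBr mulrCA.
Qed.

(** Shifting f by (a, b) moves the target point by (a, b), so the radius grows by its coordinates,
    independently of z. *)
Lemma hap_tfshift a b f : hap f -> hap (tfshift f a b).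
Proof.
move=> [Lf cf]; split; first exact: L2_tfshift.
move=> eps e0; have [r rP] := cf _ e0.
exists (r + (`|coord1 (a, b)| + `|coord2 (a, b)|)) => z.
have [s [sn sh]] := rP (a + z.1, b + z.2).
have c1E : coord1 (a + z.1, b + z.2) = coord1 z + coord1 (a, b).
  by rewrite /coord1 /det2 /=; field.
have c2E : coord2 (a + z.1, b + z.2) = coord2 z + coord2 (a, b).
  by rewrite /coord2 /det2 /=; field.
exists [seq (expi (- (2 * pi * b * z.1)) * p.1, p.2) | p <- s]; split.
  rewrite all_map; apply: sub_all sn => -[c [m [p q]]] /=.
  rewrite /close_idx /= c1E c2E !ler_norml.
  move=> /andP[/andP[h1 h2] /andP[h3 h4]].
  have := ler_norm (coord1 (a, b)); have := ler_norm (- coord1 (a, b)).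
  have := ler_norm (coord2 (a, b)); have := ler_norm (- coord2 (a, b)).
  rewrite !normrN => h5 h6 h7 h8.
  by apply/andP; split; apply/andP; split; lra.
rewrite tfshift_tfshift (_ : csub _ _ = fun t => expi (- (2 * pi * b * z.1)) *
    csub (tfshift f (a + z.1) (b + z.2)) (lincomb E s) t).
  rewrite L2normZ ?sqmod_expi ?sqrtr1 ?mul1r//.
  by apply: L2B => //; exact: L2_tfshift.
by apply/funext => t; rewrite /csub lincomb_scale mulrBr.
Qed.

Lemma hap_refspan f : hap (@chi R) -> refspan f -> hap f.
Proof.
move=> hc [s ->]; elim: s => [|p s IH].
  have := hapZ 0 hc; congr hap; apply/funext => t.
  by rewrite /lincomb big_nil mul0r.
have := hapD (hapZ p.1 (hap_tfshift p.2.1%:~R p.2.2%:~R hc)) IH.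
by congr hap; apply/funext => t; rewrite /lincomb big_cons.
Qed.

Lemma hap_all f : hap (@chi R) -> L2 f -> hap f.
Proof.
move=> hc Lf; apply: hap_lim => // eps e0.
have [_ cf] := refclosure_L2 Lf; have [h [rh fh]] := cf _ e0.
by exists h; split => //; exact: hap_refspan.
Qed.

Definition lin (st : R * R) : R * R :=
  (st.1 * v.1 + st.2 * w.1, st.1 * v.2 + st.2 * w.2).

Lemma coord1_lin st : coord1 (lin st) = st.1.
Proof. by rewrite /coord1 /lin /det2 /=; move: vw; rewrite /det2 => h; field. Qed.
Lemma coord2_lin st : coord2 (lin st) = st.2.
Proof. by rewrite /coord2 /lin /det2 /=; move: vw; rewrite /det2 => h; field. Qed.

Lemma idx_bound (s : seq (C * ('I_N * (int * int)))) : exists B : R,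
  all (fun c => (`|c.2.2.1%:~R| <= B) && (`|c.2.2.2%:~R| <= B)) s.
Proof.
elim: s => [|[c [m [p q]]] s [B IH]]; first by exists 0.
exists (Num.max B (`|p%:~R| + `|q%:~R|)); rewrite /= !le_max lerDl lerDr !normr_ge0 !orbT /=.
by apply: sub_all IH => -[c' [m' [p' q']]] /= /andP[h1 h2]; rewrite !le_max h1 h2.
Qed.

(** By continuity of the orbit of [chi], a combination that approximates at one point serves
    unchanged at all nearby points, and its finitely many indices are bounded. *)
Lemma hap_chi : complete_system E -> hap (@chi R).
Proof.
move=> cE; split; first exact: L2_chi.
move=> eps e0; have e2 : 0 < eps / 2 by rewrite divr_gt0.
have Lchi a b : L2 (tfshift (@chi R) a b) by apply: L2_tfshift; exact: L2_chi.
have K : compact (`[0, 1]%classic `*` `[0, 1]%classic : set (R * R)%type).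
  by apply: compact_setX; exact: segment_compact.
(* The radius is an integer n tending to infinity, so compactness of the unit square of coordinates
   yields one n good for the whole square. *)
have /compact_near_coveringP/(_ nat \oo
    (fun n st => approximable eps n%:R (@chi R) (lin st)) _) := K.
case.
  move=> st0 _.
  have [h [[s ->] hs]] := cE _ (Lchi (lin st0).1 (lin st0).2) _ e2.
  have [d d0 dP] := tfshift_chi_continuous (lin st0) e2.
  have [B sB] := idx_bound s.
  (* A Lipschitz bound for [lin], made positive by the last term. *)
  pose D := `|v.1| + `|v.2| + `|w.1| + `|w.2| + 1.
  have D0 : 0 < D by rewrite ltr_wpDl// !addr_ge0.
  pose d' := Num.min 1 (d / D).
  have d'0 : 0 < d' by rewrite lt_min ltr01 divr_gt0.
  (* The indices in s are bounded by B, and the coordinates of a point within 1 of st0 by those of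
     st0 plus 1. *)
  pose M := Num.truncn (B + `|st0.1| + `|st0.2| + 1).
  exists (ball st0 d', [set n | (M < n)%N]); first split => /=.
  - exact: nbhsx_ballx.
  - by exists M.+1.
  move=> [st n] [/= [b1 b2] Mn].
  rewrite /ball /= in b1 b2.
  exists s; split.
    apply: sub_all sB => -[c [m [p q]]] /= /andP[h1 h2].
    rewrite /close_idx coord1_lin coord2_lin /=.
    have hM : B + `|st0.1| + `|st0.2| + 1 < n%:R.
      by apply: lt_le_trans (truncnS_gt _) _; rewrite ler_nat.
    have b1' : `|st0.1 - st.1| < 1 by apply: lt_le_trans b1 _; rewrite ge_min lexx.
    have b2' : `|st0.2 - st.2| < 1 by apply: lt_le_trans b2 _; rewrite ge_min lexx.
    have n1 := normr_ge0 st0.1; have n2 := normr_ge0 st0.2.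
    apply/andP; split; apply: ltW.
      rewrite (_ : p%:~R - st.1 = p%:~R + (st0.1 - st.1) - st0.1); last by ring.
      apply: le_lt_trans (ler_normB _ _) _.
      by have := ler_normD p%:~R (st0.1 - st.1); lra.
    rewrite (_ : q%:~R - st.2 = q%:~R + (st0.2 - st.2) - st0.2); last by ring.
    apply: le_lt_trans (ler_normB _ _) _.
    by have := ler_normD q%:~R (st0.2 - st.2); lra.
  have lip (a b : R) : `|a| + `|b| <= D -> `|a * (st.1 - st0.1) + b * (st.2 - st0.2)| < d.
    move=> ab; have [a0|a0] := eqVneq (`|a| + `|b|) 0.
      have /eqP/normr0_eq0 -> : `|a| == 0.
        by rewrite eq_le normr_ge0 andbT -a0 lerDl.
      have /eqP/normr0_eq0 -> : `|b| == 0.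
        by rewrite eq_le normr_ge0 andbT -a0 lerDr.
      by rewrite !mul0r addr0 normr0.
    have ap : 0 < `|a| + `|b| by rewrite lt_neqAle eq_sym a0 addr_ge0.
    apply: le_lt_trans (ler_normD _ _) _; rewrite !normrM.
    apply: (@lt_le_trans _ _ ((`|a| + `|b|) * d')); last first.
      apply: (@le_trans _ _ (D * (d / D))); last by rewrite mulrC divfK ?gt_eqF.
      by apply: ler_pM; rewrite ?(ltW ap) ?(ltW d'0)// ge_min lexx orbT.
    rewrite mulrDl; move: b1 b2; rewrite distrC => b1; rewrite distrC => b2.
    have [b0|b0] := eqVneq `|b| 0.
      rewrite b0 !mul0r !addr0 ltr_pM2l//; move: ap; by rewrite b0 addr0.
    have bp : 0 < `|b| by rewrite lt_neqAle eq_sym b0 normr_ge0.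
    by rewrite ler_ltD ?ltr_pM2l// ler_wpM2l ?normr_ge0// ltW.
  rewrite (_ : csub _ _ = fun t => csub (tfshift (@chi R) (lin st).1 (lin st).2)
      (tfshift (@chi R) (lin st0).1 (lin st0).2) t +
      csub (tfshift (@chi R) (lin st0).1 (lin st0).2) (lincomb E s) t); last first.
    by apply/funext => t; rewrite /csub addrA subrK.
  apply: le_lt_trans (L2normD _ _) _; [exact: L2B|exact: L2B|].
  rewrite [ltRHS]splitr ltrD//.
  rewrite (@eq_L2norm _ _ (csub (tfshift (@chi R) (lin st0).1 (lin st0).2)
     (tfshift (@chi R) (lin st).1 (lin st).2))).
    apply: dP => /=.
      rewrite (_ : _ - _ = v.1 * (st.1 - st0.1) + w.1 * (st.2 - st0.2)); last by ring.
      apply: lip; rewrite /D; have := normr_ge0 v.2; have := normr_ge0 w.2; lra.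
    rewrite (_ : _ - _ = v.2 * (st.1 - st0.1) + w.2 * (st.2 - st0.2)); last by ring.
    apply: lip; rewrite /D; have := normr_ge0 v.1; have := normr_ge0 w.1; lra.
  by move=> t; rewrite /csub -opprB sqmodN.
move=> n0 _ /(_ n0 (leqnn n0)) Kn; exists n0%:R => z.
(* Removing integer parts of the coordinates moves z by a lattice point into the unit square. *)
pose p := Num.floor (coord1 z); pose q := Num.floor (coord2 z).
pose st := (coord1 z - p%:~R, coord2 z - q%:~R).
have stK : (`[0, 1]%classic `*` `[0, 1]%classic : set (R * R)%type) st.
  have := floor_itv (coord1 z); have := floor_itv (coord2 z).
  rewrite -/p -/q !rmorphD /= => /andP[h1 h2] /andP[h3 h4].
  by split; rewrite /= in_itv /=; apply/andP; split; lra.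
have [s [sn sh]] := Kn st stK.
have zE : z = ((lin st).1 + (lat0 v w p q).1, (lin st).2 + (lat0 v w p q).2).
  rewrite [z]surjective_pairing /lin /lat0 /latpt /st /coord1 /coord2 /det2 /=.
  by move: vw; rewrite /det2 => h; congr (_, _); field.
have [s' [s'E s'i]] := lincomb_shift g x v w p q s.
(* The shift by [lin st] followed by the lattice shift produces the factor [expi (- ph)]; the
   coefficients compensate for it. *)
pose ph : R := 2 * pi * (lin st).2 * (lat0 v w p q).1.
exists [seq (expi ph * c.1, c.2) | c <- s']; split.
  rewrite all_map.
  have : all (close_idx n0%:R z) [seq c.2 | c <- s'].
    rewrite s'i all_map; apply: sub_all sn => -[c [m [p' q']]] /=.
    rewrite /close_idx coord1_lin coord2_lin /= !rmorphD /=.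
    rewrite (_ : p'%:~R + p%:~R - coord1 z = p'%:~R - (coord1 z - p%:~R)); last by ring.
    by rewrite (_ : q'%:~R + q%:~R - coord2 z = q'%:~R - (coord2 z - q%:~R)); last by ring.
  by rewrite all_map.
rewrite (_ : csub _ _ = fun t => expi ph *
  tfshift (csub (tfshift (@chi R) (lin st).1 (lin st).2) (lincomb E s))
    (lat0 v w p q).1 (lat0 v w p q).2 t).
  rewrite L2normZ; last by apply: L2_tfshift; exact: L2B.
  rewrite sqmod_expi sqrtr1 mul1r L2norm_tfshift//; exact: L2B.
apply/funext => t; rewrite tfshiftB s'E tfshift_tfshift /csub lincomb_scale mulrBr.
by rewrite mulrA expiN mul1r {1 2}zE.
Qed.

End Approximation.

(** * Comparison of densities *)

Section RealDoubling.
Variable R : realType.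
Local Notation C := R[i].
Variables (I J : eqType) (e : I -> cfun R) (f : J -> cfun R).
Hypothesis Le : forall i, L2 (e i).
Hypothesis Lf : forall j, L2 (f j).

Definition unit2 (b : bool) : C := if b then 'i%C else 1.

Lemma sqmod_unit2 b : sqmod (unit2 b) = 1.
Proof. by case: b; rewrite /sqmod /= ?expr0n ?expr1n /= ?addr0 ?add0r. Qed.

Lemma L2valD (h k : L2sp R) t :
  ((h + k : L2sp R) : R -> C) t = (h : R -> C) t + (k : R -> C) t.
Proof. by []. Qed.

Lemma L2val_sum (K : Type) (r : seq K) (P : pred K) (F : K -> L2sp R) t :
  ((\sum_(k <- r | P k) F k : L2sp R) : R -> C) t =
  \sum_(k <- r | P k) (F k : R -> C) t.
Proof. by elim/big_rec2: _ => // k y1 y2 _ <-. Qed.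

Definition doubled (L : seq J) : seq (L2sp R) :=
  [seq L2scale (unit2 true) (toL2 (Lf j)) | j <- L] ++
  [seq L2scale (unit2 false) (toL2 (Lf j)) | j <- L].

Lemma mem_doubled L b j : j \in L -> L2scale (unit2 b) (toL2 (Lf j)) \in doubled L.
Proof.
move=> jL; rewrite /doubled mem_cat; apply/orP.
by case: b; [left|right]; apply/mapP; exists j.
Qed.

(** A complex coefficient is split into real multiples of 1 and i. The factor d lets one combination
    handle both an element and its multiple by i. *)
Lemma lincomb_real_span (L : seq J) (s : seq (C * J)) (d : C) :
  all (fun c => c.2 \in L) s -> exists2 h : L2sp R,
    span_of (fun y => y \in doubled L) h &
    forall t, (h : R -> C) t = d * lincomb f s t.
Proof.
elim: s => [_|[c j] s IH /= /andP[jL /IH[h hs hE]]].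
  by exists 0; [exact: span_of0|move=> t; rewrite /lincomb big_nil mulr0].
exists (complex.Re (d * c) *: L2scale (unit2 false) (toL2 (Lf j)) +
        (complex.Im (d * c) *: L2scale (unit2 true) (toL2 (Lf j)) + h)).
  apply: span_of_lin; first by apply: span_of_mem; exact: mem_doubled.
  by apply: span_of_lin => //; apply: span_of_mem; exact: mem_doubled.
move=> t; rewrite /lincomb big_cons mulrDr -/(lincomb f s t) !L2valD /=.
rewrite hE addrA; congr (_ + _); rewrite mul1r !mulrA -mulrDl; congr (_ * _).
by rewrite [RHS]complexE mulrC [X in _ + X]mulrC.
Qed.

(* Real scalars only see the complex span after each vector is paired with its
   multiple by i, which doubles both families. *)
Lemma complex_rank_comparison (I0 : finType) (idx : I0 -> I) (L : seq J) (delta eps : R) :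
  injective idx -> 0 < delta -> 0 <= eps ->
  (forall i h, in_span_but e i h -> delta <= L2norm (csub (e i) h)) ->
  (forall i, exists s, all (fun c => c.2 \in L) s /\
     L2norm (csub (e (idx i)) (lincomb f s)) <= eps) ->
  #|I0|%:R * (1 - eps / delta) <= (size L)%:R.
Proof.
move=> idxI d0 e0 he hf.
pose E (k : I0 * bool) := L2scale (unit2 k.2) (toL2 (Le (idx k.1))).
pose F := doubled L.
have : #|{: I0 * bool}|%:R * (1 - eps / delta) <= (size F)%:R.
  apply: (@rank_comparison _ _ (@L2ip R) (@L2ipDl R) (@L2ipZl R) (@L2ipC R)
    (@L2ip_ge0 R) _ E F delta eps d0 e0).
    move=> [i b] c.
    set D := E (i, b) - _.
    (* The total complex coefficient of [e (idx i)] in D. Its two terms lie on different axes and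
       the first has modulus 1, so |u| >= 1; dividing by u leaves [e (idx i)] minus a combination of
       the others, at distance at least delta. *)
    pose u := unit2 b - ((c (i, ~~ b))%:C)%C * unit2 (~~ b).
    have u1 : 1 <= sqmod u.
      rewrite /u /sqmod; case: b {D u} => /=.
        by rewrite ?(mul0r, mulr0, mulr1, subr0, oppr0, add0r, addr0) expr1n lerDr sqr_ge0.
      by rewrite ?(mul0r, mulr0, mulr1, subr0, oppr0, add0r, addr0) expr1n lerDl sqr_ge0.
    have u0 : u != 0 by apply: contraTneq u1 => ->; rewrite sqmod0 -ltNge.
    pose G i' := \sum_b' ((c (i', b'))%:C)%C * unit2 b'.
    pose s := [seq (u^-1 * G i', idx i') | i' <- enum I0 & i' != i].
    have DE t : (D : R -> C) t = u * csub (e (idx i)) (lincomb e s) t.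
      rewrite (_ : (D : R -> C) t = (E (i, b) : R -> C) t -
        ((\sum_(k | k != (i, b)) c k *: E k : L2sp R) : R -> C) t)//.
      rewrite L2val_sum /csub mulrBr.
      have -> : u * lincomb e s t = \sum_(i' | i' != i) G i' * e (idx i') t.
        rewrite /lincomb /s big_map big_filter big_enum_cond /= mulr_sumr.
        by apply: eq_bigr => i' _; rewrite /= !mulrA mulfV// mul1r.
      have SE : \sum_k (c k *: E k : R -> C) t = \sum_i' G i' * e (idx i') t.
        transitivity (\sum_(p : I0 * bool) (c (p.1, p.2) *: E (p.1, p.2) : R -> C) t).
          by apply: eq_bigr => -[].
        rewrite -(pair_bigA _ (fun i' b' => (c (i', b') *: E (i', b') : R -> C) t)) /=.
        by apply: eq_bigr => i' _; rewrite /G mulr_suml; apply: eq_bigr => b' _; rewrite mulrA.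
      have := SE; rewrite (bigD1 (i, b))//= [in X in _ = X -> _](bigD1 i)//= => SE'.
      have -> : \sum_(k | k != (i, b)) (c k *: E k : R -> C) t =
        G i * e (idx i) t + \sum_(i' | i' != i) G i' * e (idx i') t -
        ((c (i, b))%:C)%C * (unit2 b * e (idx i) t).
        by rewrite -SE' addrAC subrr add0r.
      by rewrite /G big_bool /u; case: (b) => /=; ring.
    have : delta <= L2norm (D : R -> C).
      rewrite (_ : (D : R -> C) = fun t => u * csub (e (idx i)) (lincomb e s) t); last first.
        by apply/funext.
      rewrite L2normZ; last by apply: L2B => //; exact: L2_lincomb.
      apply: (@le_trans _ _ (L2norm (csub (e (idx i)) (lincomb e s)))).
        apply: he; exists s; split => //; rewrite all_map; apply/allP => i'.
        by rewrite mem_filter => /andP[ii' _] /=; rewrite inj_eq.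
      by rewrite ler_peMl ?L2norm_ge0// -(@sqrtr1 R) ler_sqrt// ltW// (lt_le_trans ltr01).
    rewrite L2normE => h; rewrite -(sqr_sqrtr (L2ip_ge0 D)).
    by rewrite ler_pXn2r ?nnegrE ?sqrtr_ge0// ltW.
  move=> [i b]; have [s [sL sh]] := hf i.
  have [h hs hE] := lincomb_real_span (unit2 b) sL.
  exists h => //.
  have : L2norm ((E (i, b) - h : L2sp R) : R -> C) <= eps.
    rewrite (_ : ((E (i, b) - h : L2sp R) : R -> C) =
      fun t => unit2 b * csub (e (idx i)) (lincomb f s) t); last first.
      by apply/funext => t; rewrite /csub mulrBr -hE.
    rewrite L2normZ; last by apply: L2B => //; exact: L2_lincomb.
    by rewrite sqmod_unit2 sqrtr1 mul1r.
  rewrite L2normE => hh; rewrite -[leLHS](sqr_sqrtr (L2ip_ge0 _)).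
  by rewrite ler_pXn2r ?nnegrE ?sqrtr_ge0.
rewrite size_cat !size_map natrD card_prod card_bool /= !natrM.
have : 0 < 2 :> R by []. 
move=> _; lra.
Qed.

End RealDoubling.

(** * Elementary counting *)

Section Counting.
Variable R : realType.

Lemma quadratic_leading_le (A B D K : R) : 0 <= B -> 0 <= D -> 0 <= K ->
  (forall n : nat, A * n%:R ^+ 2 <= (B * n%:R + K) * (D * n%:R + K)) -> A <= B * D.
Proof.
move=> B0 D0 K0 H; rewrite leNgt; apply/negP => AB.
have P : 0 < A - B * D by rewrite subr_gt0.
(* For n > M the number (A - B D) n exceeds K (B + D) + K^2; multiplied by n >= 1 it beats all
   lower-order terms. *)
pose M := (K * (B + D) + K ^+ 2) / (A - B * D).
have M0 : 0 <= M.
  by apply: divr_ge0; [rewrite addr_ge0 ?mulr_ge0 ?addr_ge0 ?exprn_ge0|exact: ltW].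
pose n := (Num.truncn M).+1.
have nM : M < n%:R by exact: truncnS_gt.
have n1 : 1 <= n%:R :> R by rewrite ler1n.
move: (H n) nM n1; move: (n%:R : R) => r Hr Mr r1.
have h1 : K * (B + D) + K ^+ 2 < (A - B * D) * r.
  by rewrite [ltRHS]mulrC -ltr_pdivrMr.
have h2 : (K * (B + D) + K ^+ 2) * r < (A - B * D) * r * r.
  by rewrite ltr_pM2r// (lt_le_trans ltr01).
have h3 : K ^+ 2 <= K ^+ 2 * r by rewrite ler_peMr ?exprn_ge0.
have h4 : A * r ^+ 2 - (B * r + K) * (D * r + K) =
  ((A - B * D) * r * r - (K * (B + D) + K ^+ 2) * r) + (K ^+ 2 * r - K ^+ 2) by ring.
lra.
Qed.

Definition int_from (c r : R) (i : nat) : int := Num.floor (c - r) + i%:Z.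

(** The floor may lie almost one below c - r, so p exceeds it by less than 2r + 1; truncating 2r
    loses up to one more, hence [.+2] candidates. *)
Lemma int_fromP (c r : R) (p : int) : 0 <= r -> `|p%:~R - c| <= r ->
  exists i : 'I_(Num.truncn (2 * r)).+2, p = int_from c r i.
Proof.
move=> r0; rewrite ler_norml => /andP[h1 h2].
have /andP[f1 f2] := floor_itv (c - r); rewrite rmorphD /= in f2.
have fp : Num.floor (c - r) <= p by rewrite -(ler_int R); lra.
have ip : (`|p - Num.floor (c - r)| < (Num.truncn (2 * r)).+2)%N.
  have t := truncnS_gt (2 * r).
  rewrite -(ltr_nat R) natr_absz ger0_norm ?subr_ge0// rmorphB /= -natr1.
  lra.
exists (Ordinal ip); rewrite /int_from /= gez0_abs ?subr_ge0//; ring.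
Qed.

End Counting.

(** * The density inequality for two systems *)

Section Comparison.
Variables (R : realType) (N1 N2 : nat).
Variables (g1 : 'I_N1 -> cfun R) (x1 : 'I_N1 -> R * R) (v1 w1 : R * R).
Variables (g2 : 'I_N2 -> cfun R) (x2 : 'I_N2 -> R * R) (v2 w2 : R * R).
Hypothesis Lg1 : forall n, L2 (g1 n).
Hypothesis Lg2 : forall n, L2 (g2 n).
Hypothesis det2' : det2 v2 w2 != 0.
Hypothesis det12 : det2 v1 w2 != 0.
Local Notation E1 := (gabor_union g1 x1 v1 w1).
Local Notation E2 := (gabor_union g2 x2 v2 w2).

(* Coordinates in the basis (v1, w2), in which both lattices are triangular. *)
Let X (z : R * R) : R := det2 z w2 / det2 v1 w2.
Let Y (z : R * R) : R := det2 v1 z / det2 v1 w2.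

(** Thus w1 = kappa v1 + alpha w2 and v2 = gam v1 + kappa' w2. Here alpha and gam are the
    determinants of the two lattices divided by [det2 v1 w2], so alpha / gam is the ratio to be
    found. *)
Let kappa := X w1.
Let alpha := Y w1.
Let gam := X v2.
Let kappa' := Y v2.

Let gam0 : gam != 0. Proof. by rewrite mulf_neq0 ?invr_eq0. Qed.

(** Subtracting the floor undoes the shear: up to the offset, the X-coordinate of the point is i
    plus the fractional part of kappa j, so the grid fills an n by |alpha| n rectangle. *)
Definition grid_idx (n : nat) (i : 'I_N1 * ('I_n * 'I_n)) : 'I_N1 * (int * int) :=
  (i.1, ((i.2.1 : nat)%:Z - Num.floor (kappa * (i.2.2 : nat)%:R), (i.2.2 : nat)%:Z)).

Lemma grid_idx_inj n : injective (@grid_idx n).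
Proof.
move=> [m [i j]] [m' [i' j']] [-> h /ord_inj jj].
by move: h; rewrite jj => /addIr[/ord_inj ->].
Qed.

Lemma X_latpt x p q : X (latpt x v1 w1 p q) = X x + (p%:~R + kappa * q%:~R).
Proof. by rewrite /kappa /X /latpt; move: det12; rewrite /det2 /= => h; field. Qed.
Lemma Y_latpt x p q : Y (latpt x v1 w1 p q) = Y x + alpha * q%:~R.
Proof. by rewrite /alpha /Y /latpt; move: det12; rewrite /det2 /= => h; field. Qed.
Lemma coord1_XY z : coord1 v2 w2 z = X z / gam.
Proof.
rewrite /gam /X /coord1; move: det12 det2'; rewrite /det2 /= => h h'; field.
by rewrite h h'.
Qed.
Lemma coord2_XY z : coord2 v2 w2 z = Y z - kappa' * (X z / gam).
Proof.
rewrite /gam /kappa' /X /Y /coord2; move: det12 det2'; rewrite /det2 /= => h h'; field.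
by rewrite h h'.
Qed.

Lemma grid_bounds : exists2 B : R, 0 <= B & forall n (i : 'I_N1 * ('I_n * 'I_n)),
  let z := latpt (x1 i.1) v1 w1 (grid_idx i).2.1 (grid_idx i).2.2 in
  `|X z - n%:R / 2| <= n%:R / 2 + B /\ `|Y z - alpha * n%:R / 2| <= `|alpha| * n%:R / 2 + B.
Proof.
pose B := 1 + \sum_m (`|X (x1 m)| + `|Y (x1 m)|).
exists B; first by rewrite addr_ge0// sumr_ge0// => m _; rewrite addr_ge0.
move=> n [m [i j]] /=; rewrite X_latpt Y_latpt.
have mB : `|X (x1 m)| + `|Y (x1 m)| + 1 <= B.
  by rewrite /B (bigD1 m)//= [leLHS]addrC lerD2l lerDl sumr_ge0// => k _; rewrite addr_ge0.
have X0 := normr_ge0 (X (x1 m)); have Y0 := normr_ge0 (Y (x1 m)).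
split.
  rewrite rmorphB /=.
  have /andP[f1 f2] := floor_itv (kappa * (j : nat)%:R); rewrite rmorphD /= in f2.
  have i0 : 0 <= (i : nat)%:R :> R by [].
  have i1 : (i : nat)%:R + 1 <= n%:R :> R by rewrite natr1 ler_nat.
  have : `|X (x1 m) + ((i : nat)%:~R - (Num.floor (kappa * (j : nat)%:R))%:~R +
     kappa * (j : nat)%:~R) - n%:R / 2| <= `|X (x1 m)| + n%:R / 2.
    rewrite -addrA; apply: le_trans (ler_normD _ _) _; rewrite lerD2l ler_norml.
    by rewrite -!pmulrn; apply/andP; split; lra.
  lra.
have j0 : 0 <= (j : nat)%:R :> R by [].
have j1 : (j : nat)%:R <= n%:R :> R by rewrite ler_nat ltnW.
have : `|Y (x1 m) + alpha * (j : nat)%:~R - alpha * n%:R / 2| <= `|Y (x1 m)| + `|alpha| * n%:R / 2.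
  rewrite -addrA; apply: le_trans (ler_normD _ _) _; rewrite lerD2l.
  move: (alpha) => a; rewrite -!mulrA -mulrBr normrM.
  by rewrite ler_wpM2l// ler_norml -!pmulrn; apply/andP; split; lra.
lra.
Qed.

Lemma uniform_radius (eps : R) : 0 < eps -> complete_system E2 ->
  exists2 rho : R, 0 <= rho & forall n z, approximable g2 x2 v2 w2 eps rho (g1 n) z.
Proof.
move=> e0 cE; have hc := hap_chi Lg2 det2' cE.
have /fin_all_exists[r rP] : forall n, exists r, forall z, approximable g2 x2 v2 w2 eps r (g1 n) z.
  by move=> n; have [_] := hap_all Lg2 det2' hc (Lg1 n); apply.
exists (\sum_n `|r n|); first by rewrite sumr_ge0.
move=> n z; have [s [sn sh]] := rP n z; exists s; split => //.
apply: sub_all sn => c; apply: close_idx_le; apply: le_trans (ler_norm _) _.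
by rewrite (bigD1 n)//= lerDl sumr_ge0.
Qed.

(** A point of the second lattice has Y-coordinate kappa' p + q up to the offset, so the range of q
    is recentred for each p. *)
Definition window (n : nat) (K : R) : seq ('I_N2 * (int * int)) :=
  let r1 := n%:R / 2 / `|gam| + K in let r2 := `|alpha| * n%:R / 2 + K in
  [seq (k.1, (int_from (n%:R / 2 / gam) r1 k.2.1,
    int_from (alpha * n%:R / 2 - kappa' * (int_from (n%:R / 2 / gam) r1 k.2.1)%:~R) r2 k.2.2))
  | k : 'I_N2 * ('I_(Num.truncn (2 * r1)).+2 * 'I_(Num.truncn (2 * r2)).+2)
  <- enum {: 'I_N2 * ('I_(Num.truncn (2 * r1)).+2 * 'I_(Num.truncn (2 * r2)).+2)}].

(** In 2K + 2, the 2K is the enlargement on both sides and the 2 comes from rounding in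
    [int_fromP]. *)
Lemma size_window n K : 0 <= K -> (size (window n K))%:R <=
  N2%:R * ((`|gam|^-1 * n%:R + (2 * K + 2)) * (`|alpha| * n%:R + (2 * K + 2))).
Proof.
have succ2 (m : nat) : m.+2%:R = m%:R + 1 + 1 :> R by rewrite -!natr1.
move=> K0; rewrite size_map -cardE !card_prod !card_ord !natrM.
rewrite ler_wpM2l//; apply: ler_pM => //.
  rewrite succ2.
  have r1 : 0 <= 2 * (n%:R / 2 / `|gam| + K).
    by rewrite mulr_ge0// addr_ge0// !divr_ge0.
  have := truncn_le (2 * (n%:R / 2 / `|gam| + K)); rewrite r1 => h.
  have e : 2 * (n%:R / 2 / `|gam| + K) = `|gam|^-1 * n%:R + 2 * K.
    by field; rewrite normr_eq0.
  by apply: (@le_trans _ _ (2 * (n%:R / 2 / `|gam| + K) + 1 + 1));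
    [rewrite !lerD2r h|rewrite e; lra].
have r2 : 0 <= 2 * (`|alpha| * n%:R / 2 + K).
  by rewrite mulr_ge0// addr_ge0// !divr_ge0// mulr_ge0.
have := truncn_le (2 * (`|alpha| * n%:R / 2 + K)); rewrite r2 => h.
rewrite succ2.
by apply: (@le_trans _ _ (2 * (`|alpha| * n%:R / 2 + K) + 1 + 1)); [rewrite !lerD2r h|lra].
Qed.

Lemma window_mem n (rho B : R) z i : 0 <= rho -> 0 <= B ->
  `|X z - n%:R / 2| <= n%:R / 2 + B -> `|Y z - alpha * n%:R / 2| <= `|alpha| * n%:R / 2 + B ->
  close_idx v2 w2 rho z i ->
  i \in window n (B / `|gam| + B + rho * (2 + `|kappa'|)).
Proof.
(* The index p deviates by at most rho + B/|gam| beyond the unenlarged range and q by rho + B + rho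
   |kappa'|; K is the sum of the two. *)
set K := _ + _ + _ => r0 B0 hX hY /andP[hp hq].
have k0 := normr_ge0 kappa'.
have gp : 0 < `|gam| by rewrite normr_gt0.
have Bg : 0 <= B / `|gam| by rewrite divr_ge0.
have rk : 0 <= rho * `|kappa'| by rewrite mulr_ge0.
have K0 : 0 <= K by rewrite /K; rewrite !addr_ge0// mulr_ge0// addr_ge0.
pose r1 := n%:R / 2 / `|gam| + K; pose r2 := `|alpha| * n%:R / 2 + K.
have r10 : 0 <= r1 by rewrite addr_ge0// !divr_ge0.
have r20 : 0 <= r2 by rewrite addr_ge0// !divr_ge0// mulr_ge0.
case: i hp hq => m [p q] /=; rewrite coord1_XY coord2_XY => hp hq.
have [i1 pE] : exists i : 'I_(Num.truncn (2 * r1)).+2, p = int_from (n%:R / 2 / gam) r1 i.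
  apply: int_fromP => //.
  have -> : p%:~R - n%:R / 2 / gam = (p%:~R - X z / gam) + (X z - n%:R / 2) / gam by field.
  apply: le_trans (ler_normD _ _) _; rewrite normrM normfV.
  have : `|X z - n%:R / 2| / `|gam| <= (n%:R / 2 + B) / `|gam| by rewrite ler_pM2r ?invr_gt0.
  rewrite mulrDl /r1 /K mulrDr; lra.
have [i2 qE] : exists i : 'I_(Num.truncn (2 * r2)).+2,
    q = int_from (alpha * n%:R / 2 - kappa' * p%:~R) r2 i.
  apply: int_fromP => //.
  have -> : q%:~R - (alpha * n%:R / 2 - kappa' * p%:~R) =
    (q%:~R - (Y z - kappa' * (X z / gam))) + (Y z - alpha * n%:R / 2) +
    kappa' * (p%:~R - X z / gam) by ring.
  apply: le_trans (ler_normD _ _) _; rewrite normrM.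
  have := ler_normD (q%:~R - (Y z - kappa' * (X z / gam))) (Y z - alpha * n%:R / 2).
  have : `|kappa'| * `|p%:~R - X z / gam| <= rho * `|kappa'|.
    by rewrite [leRHS]mulrC ler_wpM2l.
  rewrite /r2 /K mulrDr; lra.
apply/mapP; exists (m, (i1, i2)); first by rewrite mem_enum.
by rewrite /= -/r1 -/r2 -pE -qE.
Qed.

Theorem comparison : uniformly_minimal E1 -> complete_system E2 ->
  N1%:R * `|det2 v2 w2| <= N2%:R * `|det2 v1 w1|.
Proof.
move=> [delta [d0 dP]] cE.
suff H : forall th : R, 0 < th -> N1%:R * (1 - th) <= N2%:R * `|gam|^-1 * `|alpha|.
  have {H} : N1%:R <= N2%:R * `|gam|^-1 * `|alpha|.
    apply/ler_addgt0Pr => e e0.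
    have Np : 0 < N1%:R + 1 :> R by rewrite ltr_wpDl.
    have := H (e / (N1%:R + 1)) (divr_gt0 e0 Np).
    have : N1%:R * (e / (N1%:R + 1)) <= e.
      by rewrite mulrCA ler_piMr ?(ltW e0)// ler_pdivrMr// mul1r lerDl.
    rewrite mulrBr mulr1; lra.
  have D0 : 0 < `|det2 v1 w2| by rewrite normr_gt0.
  have D2 : 0 < `|det2 v2 w2| by rewrite normr_gt0.
  have -> : N2%:R * `|gam|^-1 * `|alpha| = N2%:R * `|det2 v1 w1| / `|det2 v2 w2|.
    rewrite /gam /alpha /X /Y !normrM !normfV; field.
    by rewrite !normr_eq0 det12 det2'.
  by rewrite ler_pdivlMr.
move=> th th0.
(* With eps = th * delta the relative loss eps / delta in the rank comparison is th, uniformly in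
   n. *)
have e0 : 0 < th * delta by rewrite mulr_gt0.
have [rho rho0 rP] := uniform_radius e0 cE.
have [B B0 BP] := grid_bounds.
pose K := B / `|gam| + B + rho * (2 + `|kappa'|).
have K0 : 0 <= K by rewrite !addr_ge0 ?divr_ge0// mulr_ge0// addr_ge0.
have N2g : 0 <= N2%:R * `|gam|^-1 by rewrite mulr_ge0 ?invr_ge0.
(* With c = 2K + 2, the factor N2 goes into the first bracket; (N2 + 1) c then dominates both
   constant terms, N2 c and c. *)
apply: (quadratic_leading_le (K := (N2%:R + 1) * (2 * K + 2))) => // [|n].
  by rewrite mulr_ge0// addr_ge0// mulr_ge0.
apply: (@le_trans _ _ (size (window n K))%:R).
  have -> : N1%:R * (1 - th) * n%:R ^+ 2 =
    #|{: 'I_N1 * ('I_n * 'I_n)}|%:R * (1 - th * delta / delta).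
    by rewrite !card_prod !card_ord !natrM mulfK ?gt_eqF//; ring.
  apply: (complex_rank_comparison (L2_gabor x1 v1 w1 Lg1) (L2_gabor x2 v2 w2 Lg2)
    (@grid_idx_inj n) d0 (ltW e0) dP) => i.
  have [bX bY] := BP n i.
  have [s [sn sh]] := rP i.1 (latpt (x1 i.1) v1 w1 (grid_idx i).2.1 (grid_idx i).2.2).
  exists s; split; last exact: ltW.
  apply: sub_all sn => c; exact: window_mem.
apply: le_trans (size_window n K0) _.
have n0 : 0 <= n%:R :> R by [].
have N20 : 0 <= N2%:R :> R by [].
have c0 : 0 <= 2 * K + 2 by rewrite addr_ge0// mulr_ge0.
move: (2 * K + 2) c0 => c c0; rewrite mulrA; apply: ler_pM.
- by rewrite mulr_ge0// addr_ge0// mulr_ge0// invr_ge0.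
- by rewrite addr_ge0// mulr_ge0.
- by rewrite mulrDr mulrA lerD2l mulrDl mul1r lerDl.
- by rewrite lerD2l mulrDl mul1r lerDr mulr_ge0.
Qed.

End Comparison.

(** A nonzero v cannot be parallel to both standard basis vectors. *)
Lemma exists_ref_nonparallel (R : realType) (v w : R * R) : det2 v w != 0 ->
  exists b, det2 v (rv R (~~ b)) != 0.
Proof.
move=> vw; have [v10|v10] := eqVneq v.1 0.
  exists false; rewrite /det2 /= v10 mul0r mulr1 sub0r oppr_eq0.
  by apply: contraNneq vw => v20; rewrite /det2 v10 v20 !mul0r subrr.
by exists true; rewrite /det2 /= mulr1 mulr0 subr0.
Qed.

Lemma det2_ref (R : realType) b : `|det2 (rv R b) (rv R (~~ b))| = 1.
Proof. by case: b; rewrite /det2 /= ?(mulr0, mul0r, mulr1, subr0, sub0r) ?normrN normr1. Qed.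

Theorem theorem3 (R : realType) (v w : R * R) (N : nat)
  (g : 'I_N -> cfun R) (x : 'I_N -> R * R) :
  det2 v w != 0 ->
  (0 < N)%N ->
  (forall n, L2 (g n)) ->
  injective x ->
  (minimal (gabor_union g x v w) ->
     uniformly_minimal (gabor_union g x v w) /\
     lattice_density v w <= 1 / N%:R) /\
  (complete_system (gabor_union g x v w) ->
     1 / N%:R <= lattice_density v w).
Proof.
move=> vw N0 Lg _.
have dp : 0 < `|det2 v w| by rewrite normr_gt0.
have Np : 0 < N%:R :> R by rewrite ltr0n.
have Lref (n : 'I_1) : L2 (@chi R) by exact: L2_chi.
have refdet b : det2 (rv R b) (rv R (~~ b)) != 0 by rewrite -normr_gt0 det2_ref.
split=> [mE|cE].
  have uE := minimal_uniformly Lg mE; split => //.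
  have [b vb] := exists_ref_nonparallel vw.
  have := comparison Lg Lref (refdet b) vb uE (@refsys_complete R b).
  by rewrite /lattice_density !div1r det2_ref mulr1 mul1r lef_pV2 ?posrE.
(* The reference system now comes first, so the generator of the given lattice that must not be
   parallel to a basis vector is w instead of v. *)
have wv : det2 w v != 0 by rewrite /det2 -opprB oppr_eq0 [w.2 * _]mulrC [w.1 * _]mulrC.
have [b wb] := exists_ref_nonparallel wv.
have bw : det2 (rv R (~~ b)) w != 0.
  by move: wb; rewrite /det2 -opprB oppr_eq0 [w.2 * _]mulrC [w.1 * _]mulrC.
have := comparison Lref Lg vw bw (@refsys_uniformly_minimal R (~~ b)) cE.
by rewrite /lattice_density !div1r det2_ref mulr1 mul1r lef_pV2 ?posrE.
Qed.
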